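(* Let $\gamma = (\gamma_\alpha)_{\alpha \in \mathbf{Z}_+^n}$ ($\gamma_0 > 0$) be an $n$-sequence of real numbers, and let $\mathbf{p} = (p_1, \ldots, p_m)$ be an $m$-tuple of real polynomials on $\mathbf{R}^n$, where $p_k(t) = \sum_{\xi \in I_k} a_{k\xi} t^\xi$, $k = 1, \ldots, m$, with $I_k \subset \mathbf{Z}_+^n$ finite for all $k$. Then $\gamma$ is a moment sequence having a representing measure whose support is in the set $\bigcap_{k=1}^m p_k^{-1}(\mathbf{R}_+)$ if and only if there exists a positive semi-definite $(n+1)$-sequence $\delta = (\delta_{(\alpha,\beta)})_{(\alpha,\beta) \in \mathbf{Z}_+^n \times \mathbf{Z}_+}$ with the following properties: (1) $\gamma_\alpha = \delta_{(\alpha,0)}$ for all $\alpha \in \mathbf{Z}_+^n$. (2) $\delta_{(\alpha,\beta)} = \delta_{(\alpha,\beta+1)} + \sum_{j=1}^n \delta_{(\alpha+2e_j,\beta+1)} + \sum_{k=1}^m \sum_{\xi,\eta \in I_k} a_{k\xi} a_{k\eta}\, \delta_{(\alpha+\xi+\eta,\beta+1)}$ for all $\alpha \in \mathbf{Z}_+^n$, $\beta \in \mathbf{Z}_+$. (3) The $(n+1)$-sequences $\left(\sum_{\xi \in I_k} a_{k\xi}\, \delta_{(\alpha+\xi,\beta)}\right)_{(\alpha,\beta) \in \mathbf{Z}_+^n \times \mathbf{Z}_+}$ are positive semi-definite for all $k = 1, \ldots, m$. The $n$-sequence $\gamma$ has a uniquely determined representing measure on $\bigcap_{k=1}^m p_k^{-1}(\mathbf{R}_+)$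 if and only if the $(n+1)$-sequence $\delta$ (satisfying these properties) is unique.
   Context: $n \ge 1$ is a fixed integer; $\mathbf{Z}_+$ is the set of nonnegative integers; $\mathbf{R}_+ = [0,\infty)$; $t^\alpha = t_1^{\alpha_1}\cdots t_n^{\alpha_n}$; $e_j \in \mathbf{Z}_+^n$ is the multi-index whose coordinates are null except the $j$th, which equals $1$. For $N \ge 1$, $\mathcal{P}_N$ is the algebra of polynomial functions on $\mathbf{R}^N$ with complex coefficients. An $N$-sequence $\gamma = (\gamma_\alpha)_{\alpha \in \mathbf{Z}_+^N}$ is positive semi-definite if the associated linear map $L_\gamma : \mathcal{P}_N \to \mathbf{C}$, $L_\gamma(t^\alpha) = \gamma_\alpha$, satisfies $L_\gamma(f\bar f) \ge 0$ for all $f \in \mathcal{P}_N$. An $n$-sequence $\gamma$ is a moment sequence if there is a positive Borel measure $\mu$ on $\mathbf{R}^n$ (a representing measure for $\gamma$) such that $\mathcal{P}_n \subset L^2(\mu)$ and $\gamma_\alpha = \int t^\alpha\, d\mu(t)$ for all $\alpha \in \mathbf{Z}_+^n$. *)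

(* Defs.v *)
From HB Require Import structures.
From mathcomp Require Import all_boot all_order all_algebra finmap.
From mathcomp Require Import all_classical all_reals all_analysis.
From mathcomp Require Import complex.
(* The notations of mpoly are incompatible with those of mathcomp-analysis. *)
From mathcomp Require Export -(notations) mpoly.

Set Implicit Arguments.
Unset Strict Implicit.
Unset Printing Implicit Defensive.

Import Order.TTheory GRing.Theory Num.Theory.
Import numFieldNormedType.Exports.

Local Open Scope classical_set_scope.
Local Open Scope ring_scope.
Local Open Scope complex_scope.

Notation "{ 'mpoly' T [ n ] }" := (mpoly n T) : type_scope.
Notation "m1 +m m2" := (mnm_add m1 m2) (at level 50, left associativity).

Section PositiveSemidefinite.
Variables (R : realType) (N : nat).

Definition riesz (gamma : multinom N -> R[i]) (f : {mpoly R[i][N]}) : R[i] :=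
  \sum_(m <- msupp f) mcoeff m f * gamma m.

(* On R[i], 0 <= z means that z is real and nonnegative. *)
Definition psd (gamma : multinom N -> R[i]) : Prop :=
  forall f : {mpoly R[i][N]}, 0 <= riesz gamma (f * map_mpoly conjc f).

End PositiveSemidefinite.

Section PairIndex.
Variables (R : realType) (n : nat).

(* multinom n.+1 is identified with multinom n * nat, the nat being the exponent
   of the last variable. *)
Definition mnm_split (mu : multinom n.+1) : multinom n * nat :=
  (Multinom [tuple mu (widen_ord (leqnSn n) i) | i < n], mu ord_max).

Definition psd_pair (delta : multinom n * nat -> R[i]) : Prop :=
  psd (delta \o mnm_split).

End PairIndex.

Section Moments.
Variables (R : realType) (n : nat).

Definition borelRn := g_sigma_algebraType (@open 'rV[R]_n).

Definition monomial (alpha : multinom n) (t : 'rV[R]_n) : R :=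
  \prod_(i < n) t ord0 i ^+ alpha i.

Definition real_eval (p : {mpoly R[n]}) (t : 'rV[R]_n) : R :=
  meval (fun i => t ord0 i) p.

Definition complex_eval (f : {mpoly R[i][n]}) (t : 'rV[R]_n) : R[i] :=
  meval (fun i => (t ord0 i)%:C) f.

(* A complex polynomial function, being continuous, is in L^2 iff its modulus
   is. *)
Definition representing (gamma : multinom n -> R)
    (mu : {measure set borelRn -> \bar R}) : Prop :=
  (forall f : {mpoly R[i][n]},
     (fun t => ComplexField.Normc.normc (complex_eval f t)) \in Lfun mu 2%:E) /\
  (forall alpha : multinom n,
     (gamma alpha)%:E = (\int[mu]_(t in setT) (monomial alpha t)%:E)%E).

Definition msupport (mu : {measure set borelRn -> \bar R}) : set 'rV[R]_n :=
  [set t | forall U : set 'rV[R]_n, open U -> U t -> (0 < mu U)%E].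

Definition representing_on (K : set 'rV[R]_n) (gamma : multinom n -> R)
    (mu : {measure set borelRn -> \bar R}) : Prop :=
  representing gamma mu /\ msupport mu `<=` K.

End Moments.

Section Extension.
Variables (R : realType) (n m : nat).
Variables (I : 'I_m -> {fset multinom n}) (a : 'I_m -> multinom n -> R).

Definition extension (gamma : multinom n -> R)
    (delta : multinom n * nat -> R[i]) : Prop :=
  [/\ psd_pair delta,
      forall alpha, (gamma alpha)%:C = delta (alpha, 0%N),
      forall alpha beta,
        delta (alpha, beta) =
          delta (alpha, beta.+1)
          + \sum_(j < n) delta (alpha +m mnm_muln (mnm1 j) 2, beta.+1)
          + \sum_(k < m) \sum_(xi <- I k) \sum_(eta <- I k)
              (a k xi)%:C * (a k eta)%:C
                * delta (alpha +m xi +m eta, beta.+1)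
    & forall k : 'I_m,
        psd_pair (fun ab =>
          \sum_(xi <- I k) (a k xi)%:C * delta (ab.1 +m xi, ab.2))].

End Extension.

(* Main.v *)
Require Import Defs.
From HB Require Import structures.
From mathcomp Require Import all_boot all_order all_algebra finmap.
From mathcomp Require Import all_classical all_reals all_analysis.
From mathcomp Require Import measurable_realfun.
From mathcomp Require Import ring lra zify.
From mathcomp Require Import complex.

Set Implicit Arguments.
Unset Strict Implicit.
Unset Printing Implicit Defensive.

Import Order.TTheory GRing.Theory Num.Theory.
Import numFieldNormedType.Exports.

Local Open Scope classical_set_scope.
Local Open Scope ring_scope.

(** An extension delta is the moment sequence of a measure mu on R^n in the
    functions t^alpha theta^beta, where theta = 1 / (1 + |t|^2 + sum_k p_k^2) is
    the value of the extra variable.  Given mu on the set K where all p_k are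
    nonnegative, integrating these functions gives an extension
    ([moments_of_representing]).  The work lies in the converse and in the
    determinacy of mu by delta.

    Existence ([moments_exist]).  An extension is real, hence is a linear form L on
    the real polynomials in (t, theta) that is nonnegative on squares and does not
    see the difference between theta * rho and 1, where rho = 1 + |t|^2 + sum_k p_k^2.
    Modulo this relation theta = theta^2 rho is a sum of squares, and so are
    1 - theta = theta (rho - 1) and 1/2 +- theta t_j = theta (rho +- 2 t_j) / 2.
    Thus the n + 1 elements u = (theta, 1/2 + theta t_j) behave like coordinates
    on [0, 1]^(n+1): L is nonnegative on every product of factors u_i and
    1 - u_i.  This is the positivity asked for by the Hausdorff moment problem.
    As in its classical proof, the numbers L (prod_i bernstein k j_i u_i) are the
    weights of a measure on the grid of mesh 1/k, and the moments of these measures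
    converge to those of L ([cvg_bernstein_moment]).  A limit measure is made by
    hand ([weak_limit]): binary digits turn points of the cube into infinite words,
    the masses of the words with a given prefix converge along an ultrafilter, and
    the limit masses, which form an additive tree, are laid out as nested intervals
    of the real line.  Reading the digits back from a point of the line
    gives a random point of the cube, under Lebesgue measure on an interval.

    Return to unbounded functions ([unbounded_representation]).  Every monomial
    t^alpha theta^beta equals rho^M g with g a polynomial in u, and rho is the
    increasing limit of the polynomials sum_(i < k) (1 - theta)^i.  The error of this
    approximation under L is at most L (rho^(M+1)) / (k+1), so monotone and dominated
    convergence show that the coordinate theta vanishes almost nowhere and
    that L is integration of all polynomials in (t, theta), with t = (theta t) / theta.
    As L kills (theta rho - 1)^2, theta is 1 / rho (t) almost everywhere.

    Determinacy and support.  Iterating x -> (3 x - x^3) / 2 gives polynomials that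
    converge boundedly to the sign on [-1, 1] ([cvg_step_approx]).  Since theta,
    theta t_j and theta p_k are bounded, indicators of boxes of R^n and of
    the sets where p_k < 0 are bounded limits of polynomials in (t, theta).  So
    mu is determined by delta ([moments_determine]), and the positivity of p_k L
    forces p_k >= 0 almost everywhere ([support_of_moments]).  The two uniqueness
    statements are then equivalent: mu and delta determine each other. *)

(** * Integrable functions with a given integral *)

Section HasIntegral.
Context d (T : measurableType d) (R : realType).
Implicit Types (mu : {measure set T -> \bar R}) (f g : T -> R) (c : R).

(** Integrability and value travel together, so that the linear and limit rules
    below apply to equations between integrals without side conditions. *)
Definition has_integral mu f c :=
  mu.-integrable setT (EFin \o f) /\ (\int[mu]_x (f x)%:E)%E = c%:E.

Lemma has_integral_measurable mu f c : has_integral mu f c -> measurable_fun setT f.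
Proof. by move=> [/measurable_int/measurable_EFinP]. Qed.

Lemma has_integral_unique mu f c c' :
  has_integral mu f c -> has_integral mu f c' -> c = c'.
Proof. by move=> [_ +] [_ +]; move=> -> []. Qed.

Lemma integrable_has_integral mu f :
  mu.-integrable setT (EFin \o f) -> exists c, has_integral mu f c.
Proof.
move=> intf; exists (fine (\int[mu]_x (f x)%:E)%E); split => //.
by rewrite fineK//; exact: (@integrable_fin_num _ _ _ mu setT measurableT).
Qed.

Lemma eq_has_integral mu f g c : f =1 g -> has_integral mu f c -> has_integral mu g c.
Proof. by move=> /funext ->. Qed.

Lemma has_integralD mu f g c c' : has_integral mu f c -> has_integral mu g c' ->
  has_integral mu (fun x => f x + g x) (c + c').
Proof.
move=> [intf fc] [intg gc]; split; last first.
  by rewrite (integralD measurableT intf intg) /= fc gc.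
by rewrite (_ : EFin \o _ = (EFin \o f) \+ (EFin \o g))%E //; apply: integrableD.
Qed.

Lemma has_integralZ mu k f c : has_integral mu f c ->
  has_integral mu (fun x => k * f x) (k * c).
Proof.
move=> [intf fc]; split; last by rewrite (integralZl measurableT intf) fc.
rewrite (_ : EFin \o _ = (fun x => k%:E * (EFin \o f) x))%E //.
exact: integrableZl.
Qed.

Lemma has_integralN mu f c : has_integral mu f c ->
  has_integral mu (fun x => - f x) (- c).
Proof.
move=> /(has_integralZ (-1)); rewrite mulN1r; apply: eq_has_integral => x.
by rewrite mulN1r.
Qed.

Lemma has_integral0 mu : has_integral mu (fun=> 0) 0.
Proof.
split; last exact: integral0.
by rewrite (_ : EFin \o _ = cst 0%E)//; exact: integrable0.
Qed.

Lemma has_integral_sum mu (I : Type) (s : seq I) (F : I -> T -> R) (C : I -> R) :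
  (forall i, has_integral mu (F i) (C i)) ->
  has_integral mu (fun x => \sum_(i <- s) F i x) (\sum_(i <- s) C i).
Proof.
move=> FC; elim: s => [|i s IHs].
  rewrite big_nil; apply: eq_has_integral (has_integral0 mu) => x.
  by rewrite big_nil.
rewrite big_cons; apply: eq_has_integral (has_integralD (FC i) IHs) => x.
by rewrite big_cons.
Qed.

Lemma has_integral_le mu f g c c' : has_integral mu f c -> has_integral mu g c' ->
  (forall x, f x <= g x) -> c <= c'.
Proof.
move=> [intf fc] [intg gc] fg; rewrite -lee_fin -fc -gc.
by apply: le_integral => // x _; rewrite /= lee_fin.
Qed.

Lemma has_integral_ge0 mu f c : has_integral mu f c -> (forall x, 0 <= f x) -> 0 <= c.
Proof. by move=> fc f0; apply: has_integral_le (has_integral0 mu) fc f0. Qed.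

Lemma dominated_has_integral mu f g c : measurable_fun setT f ->
  (forall x, `|f x| <= g x) -> has_integral mu g c -> exists c', has_integral mu f c'.
Proof.
move=> mf fg [intg _]; apply: integrable_has_integral.
apply: (le_integrable measurableT _ _ intg); first exact/measurable_EFinP.
move=> x _ /=; rewrite lee_fin; apply: le_trans (fg x) _; exact: ler_norm.
Qed.

Lemma has_integral_ae mu f g c : measurable_fun setT g ->
  {ae mu, forall x, f x = g x} -> has_integral mu f c -> has_integral mu g c.
Proof.
move=> mg fg [intf fc]; have fg' : ae_eq mu setT (EFin \o f) (EFin \o g).
  by apply: filterS fg => x /= -> .
have mf := measurable_int _ intf.
split; last first.
  rewrite -fc; apply/esym; apply: ae_eq_integral => //; exact/measurable_EFinP.
have [mf' intf'] := integrableP _ _ _ intf.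
apply/integrableP; split; first exact/measurable_EFinP.
rewrite (le_lt_trans _ intf')// le_eqVlt; apply/orP; left; apply/eqP.
apply: ae_eq_integral => //.
- by apply: measurableT_comp => //; exact/measurable_EFinP.
- exact: measurableT_comp.
- by apply: filterS fg => x /= ->.
Qed.

Lemma has_integral_lim mu (f_ : nat -> T -> R) (c_ : nat -> R) f g c :
  (forall k, has_integral mu (f_ k) (c_ k)) ->
  (forall x, f_ ^~ x @ \oo --> f x) ->
  has_integral mu g c -> (forall k x, `|f_ k x| <= g x) ->
  exists2 c', has_integral mu f c' & c_ @ \oo --> c'.
Proof.
move=> fc ff [intg _] fg.
have mf_ k : measurable_fun setT (f_ k) by exact: has_integral_measurable (fc k).
have mf : measurable_fun setT f by exact: (measurable_fun_cvg (fun k => mf_ k)).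
have [] := @dominated_convergence _ _ _ mu setT measurableT
  (fun k => EFin \o f_ k) (EFin \o f) (EFin \o g).
- by move=> k; exact/measurable_EFinP.
- exact/measurable_EFinP.
- by apply: aeW => x _; apply/cvg_EFin; [exact: nearW|exact: ff].
- exact: intg.
- by apply: aeW => x k _ /=; rewrite lee_fin.
move=> /integrable_has_integral[c' Ic'] _ cvgc; exists c' => //.
move: cvgc; rewrite Ic'.2 => /fine_cvg.
by rewrite (_ : fine \o _ = c_)//; apply/funext => k /=; rewrite (fc k).2.
Qed.

(** A uniform bound of the integrals of an increasing sequence is what makes its
    pointwise limit integrable. *)
Lemma has_integral_monotone mu (f_ : nat -> T -> R) (c_ : nat -> R) f B :
  (forall k, has_integral mu (f_ k) (c_ k)) ->
  (forall x, f_ ^~ x @ \oo --> f x) ->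
  (forall k x, 0 <= f_ k x) ->
  (forall x, {homo f_ ^~ x : k l / (k <= l)%N >-> k <= l}) ->
  (forall k, c_ k <= B) -> exists c, has_integral mu f c.
Proof.
move=> fc ff f0 fnd cB.
have mf_ k : measurable_fun setT (f_ k) by exact: has_integral_measurable (fc k).
have mf : measurable_fun setT f by exact: (measurable_fun_cvg (fun k => mf_ k)).
apply: integrable_has_integral; apply/integrableP; split; first exact/measurable_EFinP.
have f_ge0 x : 0 <= f x by apply: (cvgr_to_ge (ff x)); exact: nearW.
under eq_integral do rewrite /= ger0_norm//.
have cvgf : (\int[mu]_x (EFin \o f_ k) x)%E @[k --> \oo] --> (\int[mu]_x (f x)%:E)%E.
  have -> : (\int[mu]_x (f x)%:E = \int[mu]_x (limn (fun k => (EFin \o f_ k) x)))%E.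
    apply: eq_integral => x _; apply/esym/cvg_lim => //.
    by apply: cvg_EFin; [exact: nearW | exact: ff].
  apply: cvg_monotone_convergence => //.
  - by move=> k; exact/measurable_EFinP.
  - by move=> k x _; rewrite /= lee_fin.
  - by move=> x _ k l kl; rewrite /= lee_fin; exact: fnd.
apply: (@le_lt_trans _ _ B%:E); last exact: ltry.
have cB' : \forall k \near \oo, (\int[mu]_x (EFin \o f_ k) x <= B%:E)%E.
  by apply: nearW => k; rewrite (fc k).2 lee_fin.
by rewrite -(cvg_lim _ cvgf)//; apply: lime_le => //; apply/cvg_ex; eexists; exact: cvgf.
Qed.

Lemma has_integral_eq0 mu f : has_integral mu f 0 -> (forall x, 0 <= f x) ->
  {ae mu, forall x, f x = 0}.
Proof.
move=> [intf f0] fge0.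
have mf := measurable_int _ intf.
have : (\int[mu]_x `|(EFin \o f) x| = 0)%E.
  by rewrite -[RHS]f0; apply: eq_integral => x _ /=; rewrite ger0_norm.
move/(ae_eq_integral_abs mu measurableT mf).
by apply: filterS => x /= /(_ I)[].
Qed.

Lemma has_integral_cst mu c : (mu setT < +oo)%E ->
  has_integral mu (fun=> c) (c * fine (mu setT)).
Proof.
move=> mufin.
have : mu setT \is a fin_num by rewrite ge0_fin_numE.
move=> fm; split; last by rewrite integral_cst// -{1}(fineK fm).
apply: measurable_bounded_integrable => //.
exists `|c|; split; first exact: num_real.
by move=> y cy x _; exact: ltW.
Qed.

Lemma has_integral_indic mu A : (mu setT < +oo)%E -> measurable A ->
  has_integral mu (\1_A) (fine (mu A)).
Proof.
move=> mufin mA; split; last first.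
  rewrite integral_indic// setIT fineK// ge0_fin_numE//.
  by apply: le_lt_trans mufin; apply: le_measure; rewrite ?inE.
apply: measurable_bounded_integrable => //.
exists 1; split; first exact: num_real.
move=> y cy x _ /=; rewrite indicE ger0_norm; last by case: (_ \in _).
apply: le_trans (ltW cy).
by case: (_ \in _).
Qed.

End HasIntegral.

(** * Trees of masses as intervals of the line *)

Section MassTree.
Variables (R : realType) (m : seq bool -> R).
Hypothesis m_ge0 : forall s, 0 <= m s.
Hypothesis mD : forall s, m s = m (false :: s) + m (true :: s).

(** Words are read from their end: the head of a word is its last digit, so the
    word [b :: s] is a child of [s].  The interval of a word is cut into those of
    its children, the child [false :: s] on the left. *)
Fixpoint left_end (s : seq bool) : R :=
  if s is b :: s' then left_end s' + (if b then m (false :: s') else 0) else 0.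

Fixpoint address (h : nat) (x : R) : seq bool :=
  if h is h'.+1 then
    let s := address h' x in (left_end s + m (false :: s) <= x) :: s
  else [::].

Lemma size_address h x : size (address h x) = h.
Proof. by elim: h => //= h ->. Qed.

Lemma left_end_ge0 s : 0 <= left_end s.
Proof. by elim: s => //= b s IHs; rewrite addr_ge0//; case: b. Qed.

Lemma right_end_le s : left_end s + m s <= m [::].
Proof.
elim: s => [|b s IHs] /=; first by rewrite add0r.
apply: le_trans IHs; rewrite (mD s); have := m_ge0 (true :: s).
by case: b; lra.
Qed.

(** Additivity of [m] makes the intervals of the two children of a word exactly
    fill the interval of the word, so induction on [s] applies. *)
Lemma address_eq s x : 0 <= x < m [::] ->
  (address (size s) x == s) = (left_end s <= x < left_end s + m s).
Proof.
move=> x0T; elim: s => [|b s IHs] /=; first by rewrite add0r x0T eqxx.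
rewrite eqseq_cons; case: (address _ x =P s) IHs => [-> | _] IHs; last first.
  rewrite andbF; apply/esym/negP => /andP[sx xs].
  suff : false by []. rewrite IHs (mD s).
  have := m_ge0 (false :: s); have := m_ge0 (true :: s).
  by case: b sx xs => sx xs ? ?; apply/andP; split; lra.
have /esym/andP[sx xs] := IHs; rewrite andbT (mD s) in xs *.
case: b => /=; rewrite ?eqb_id.
  by rewrite addrA in xs; rewrite xs andbT.
by rewrite addr0 sx /= eqbF_neg -ltNge.
Qed.

Lemma measurable_address h s : measurable [set x : R | address h x = s].
Proof.
elim: h s => [|h IHh] [|b s] /=.
- by rewrite (_ : [set _ | _] = setT)//; apply/seteqP; split.
- by rewrite (_ : [set _ | _] = set0)//; apply/seteqP; split.
- by rewrite (_ : [set _ | _] = set0)//; apply/seteqP; split.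
rewrite (_ : [set _ | _] = [set x | address h x = s] `&`
  (if b then `[left_end s + m (false :: s), +oo[%classic
        else `]-oo, left_end s + m (false :: s)[%classic)).
  by apply: measurableI => //; case: b.
apply/seteqP; split => x /=.
  move=> [+ xs]; rewrite xs => <-; split=> //.
  by case: leP => /=; rewrite in_itv/= ?andbT.
move=> [-> ]; case: b => /=; rewrite in_itv/= ?andbT; first by move=> ->.
by rewrite ltNge => /negbTE ->.
Qed.

Definition tree_measure := mrestr (@lebesgue_measure R) (measurable_itv `[0, m [::][).
HB.instance Definition _ := Measure.on tree_measure.

Lemma tree_measure_address s :
  tree_measure [set x | address (size s) x = s] = (m s)%:E.
Proof.
rewrite /tree_measure /mrestr.
rewrite (_ : _ `&` _ = `[left_end s, left_end s + m s[%classic).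
  rewrite lebesgue_measure_itv/= lte_fin ltrDl; case: ltP => [_|ms].
    by rewrite -EFinD addrAC subrr add0r.
  by congr EFin; apply/le_anti; rewrite ms m_ge0.
apply/seteqP; split => x /=; rewrite !in_itv/=.
  by move=> [/eqP + x0]; rewrite address_eq.
move=> sx; have x0T : 0 <= x < m [::].
  case/andP: sx => sx xs; rewrite (le_trans (left_end_ge0 s) sx)/=.
  exact: lt_le_trans xs (right_end_le s).
by split=> //; apply/eqP; rewrite address_eq.
Qed.

Lemma tree_measureT : tree_measure setT = (m [::])%:E.
Proof.
by rewrite -(tree_measure_address [::]); congr tree_measure; apply/seteqP; split.
Qed.

Lemma has_integral_address h (F : seq bool -> R) :
  has_integral tree_measure (fun x => F (address h x))
    (\sum_(s : h.-tuple bool) F s * m s).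
Proof.
pose f (s : h.-tuple bool) (x : R) := F s * \1_[set x | address h x = s] x.
suff If s : has_integral tree_measure (f s) (F s * m s).
  apply: eq_has_integral (has_integral_sum (index_enum _) If).
  move=> x; rewrite (bigD1 (Tuple (introT eqP (size_address h x))))//= big1 /f /=.
    by rewrite addr0 indicE mem_set// mulr1.
  move=> s; rewrite -val_eqE/= => sx; rewrite indicE memNset ?mulr0//= => xs.
  by move: sx; rewrite xs eqxx.
apply: has_integralZ.
rewrite -[m s]/(fine (m s)%:E) -tree_measure_address size_tuple.
apply: has_integral_indic; last exact: measurable_address.
by have : (tree_measure setT < +oo)%E by rewrite tree_measureT ltry.
Qed.

Lemma measurable_fun_address h (F : seq bool -> R) :
  measurable_fun setT (fun x : R => F (address h x)).
Proof. exact: has_integral_measurable (has_integral_address h F). Qed.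

End MassTree.

(** * Limits of discrete measures on the cube *)

Section BinaryDigits.
Variable R : realType.
Implicit Types (x : R) (b : nat -> bool).

(** Greedy digits: the rest stays in [0, 1], endpoints included, so that 1 has the
    expansion with all digits 1 and the closed interval needs no special point. *)
Fixpoint digit_rest x (l : nat) : R :=
  if l is l'.+1 then
    2 * digit_rest x l' - (2^-1 <= digit_rest x l')%R%:R
  else x.

Definition digit x l : bool := 2^-1 <= digit_rest x l.

Lemma digit_rest_itv x l : 0 <= x <= 1 -> 0 <= digit_rest x l <= 1.
Proof.
move=> x01; elim: l => //= l /andP[? ?].
by case: (leP 2^-1 (digit_rest x l)) => /= ?; apply/andP; split; lra.
Qed.

Lemma digit_expansion x h :
  x = \sum_(l < h) (digit x l)%:R * 2 ^- l.+1 + digit_rest x h * 2 ^- h.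
Proof.
elim: h => [|h IHh]; first by rewrite big_ord0 add0r expr0 invr1 mulr1.
rewrite big_ord_recr/= [LHS]IHh -addrA; congr (_ + _).
have h2 : (2 : R) ^- h = 2 * 2 ^- h.+1.
  by rewrite exprS invfM mulrA divff ?mul1r// pnatr_eq0.
by rewrite h2 /digit; ring.
Qed.

Variable I : finType.
Implicit Type i : I.

(** The digits of all coordinates are stored in a single word: digit number [l] of
    coordinate [i] sits at the code of the pair [(i, l)]. *)
Definition bit_sum b i h : R := \sum_(l < h) (b (choice.pickle (i, val l)))%:R * 2 ^- l.+1.

Lemma bit_sumS b i h :
  bit_sum b i h.+1 = bit_sum b i h + (b (choice.pickle (i, h)))%:R * 2 ^- h.+1.
Proof. by rewrite /bit_sum big_ord_recr. Qed.

Lemma bit_sum_near b i h k :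
  bit_sum b i h <= bit_sum b i (h + k) <= bit_sum b i h + 2 ^- h - 2 ^- (h + k).
Proof.
elim: k => [|k /andP[IH1 IH2]]; first by rewrite addn0 addrK lexx.
rewrite addnS bit_sumS.
have h2 : (2 : R) ^- (h + k) = 2 * 2 ^- (h + k).+1.
  by rewrite exprS invfM mulrA divff ?mul1r// pnatr_eq0.
have : 0 < 2 ^- (h + k).+1 :> R by rewrite invr_gt0 exprn_gt0.
by move: IH2; rewrite h2; case: (b _) => /=; lra.
Qed.

Lemma nondecreasing_bit_sum b i : {homo bit_sum b i : h k / (h <= k)%N >-> h <= k}.
Proof. by move=> h k /subnKC <-; case/andP: (bit_sum_near b i h (k - h)). Qed.

Lemma bit_sum_itv b i h : 0 <= bit_sum b i h <= 1.
Proof.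
have := bit_sum_near b i 0 h; rewrite add0n [bit_sum b i 0]big_ord0 expr0 invr1.
have : 0 < 2 ^- h :> R by rewrite invr_gt0 exprn_gt0.
lra.
Qed.

Definition bit_limit b i : R := limn (bit_sum b i).

Lemma cvg_bit_sum b i : bit_sum b i @ \oo --> bit_limit b i.
Proof.
apply: nondecreasing_is_cvgn; first exact: nondecreasing_bit_sum.
by exists 1 => _ [h _ <-]; case/andP: (bit_sum_itv b i h).
Qed.

Lemma bit_limit_near b i h :
  bit_sum b i h <= bit_limit b i <= bit_sum b i h + 2 ^- h.
Proof.
have cb : cvgn (bit_sum b i) by apply/cvg_ex; exists (bit_limit b i); exact: cvg_bit_sum.
apply/andP; split; [apply: limr_ge; first exact: cb | apply: limr_le; first exact: cb].
  by exists h => // k /= hk; exact: nondecreasing_bit_sum.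
exists h => // k /= /subnKC <-; case/andP: (bit_sum_near b i h (k - h)) => _.
have : 0 < 2 ^- (h + (k - h)) :> R by rewrite invr_gt0 exprn_gt0.
lra.
Qed.

Lemma bit_limit_itv b i : 0 <= bit_limit b i <= 1.
Proof.
by have := bit_limit_near b i 0; rewrite [bit_sum b i 0]big_ord0 expr0 invr1 add0r.
Qed.

Definition point_bits (x : I -> R) (h : nat) : bool :=
  if choice.unpickle h is Some (i, l) then digit (x i) l else false.

Lemma point_bits_near (x : I -> R) i h : 0 <= x i <= 1 ->
  `|x i - bit_sum (point_bits x) i h| <= 2 ^- h.
Proof.
move=> xi01; rewrite (_ : bit_sum _ i h = \sum_(l < h) (digit (x i) l)%:R * 2 ^- l.+1).
  rewrite {1}(digit_expansion (x i) h) addrAC subrr add0r.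
  have /andP[r0 r1] := digit_rest_itv h xi01.
  by rewrite ger0_norm ?mulr_ge0// ler_piMl.
by apply: eq_bigr => l _; rewrite /point_bits choice.pickleK.
Qed.

Fixpoint bit_prefix b h : seq bool := if h is h'.+1 then b h' :: bit_prefix b h' else [::].

Definition bit_of (s : seq bool) h : bool := nth false s (size s - h.+1).

Lemma size_bit_prefix b h : size (bit_prefix b h) = h.
Proof. by elim: h => //= h ->. Qed.

Lemma bit_of_prefix b h k : (k < h)%N -> bit_of (bit_prefix b h) k = b k.
Proof.
rewrite /bit_of size_bit_prefix; elim: h => // h IHh.
rewrite ltnS leq_eqVlt => /orP[/eqP ->|kh]; first by rewrite subnn.
by rewrite subSn//= IHh.
Qed.

(** A prefix of this length contains the first [h] digits of every coordinate. *)
Definition depth h : nat := \max_(i : I) \max_(l < h) (choice.pickle (i, val l)).+1.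

Lemma bit_sum_prefix b i h : bit_sum (bit_of (bit_prefix b (depth h))) i h = bit_sum b i h.
Proof.
apply: eq_bigr => l _; rewrite bit_of_prefix//.
apply: leq_trans (leq_bigmax i).
exact: (leq_bigmax (F := fun l : 'I_h => (choice.pickle (i, val l)).+1) l).
Qed.

End BinaryDigits.
Arguments bit_sum {R I} b i h.
Arguments bit_limit {R I} b i.
Arguments bit_sum_prefix {R I} b i h.
Arguments bit_limit_itv {R I} b i.
Arguments bit_limit_near R {I} b i h.
Arguments bit_sum_itv {R I} b i h.
Arguments cvg_bit_sum {R I} b i.

Section WeakLimit.
Variable R : realType.

(** Limits along an ultrafilter replace the extraction of a subsequence on which
    countably many masses converge. *)
Lemma ultra_bounded_cvg (U : set_system nat) (y : nat -> R) T : UltraFilter U ->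
  (forall k, 0 <= y k <= T) -> exists l : R, y @ U --> l.
Proof.
move=> UU y0T; have := @segment_compact R 0 T; rewrite compact_ultra => cT.
have yUU : UltraFilter (y @ U).
  split=> [|G PG yUG]; first exact: fmap_proper_filter.
  apply/seteqP.
  split=> [A GA|]; last exact: yUG.
  have [//|/(yUG (~` A)) GnA] := in_ultra_setVsetC (y @^-1` A) UU.
  by have /filter_ex[z []] : G (A `&` ~` A) by exact: filterI.
have [|l [_ yl]] := cT (y @ U) yUU.
  suff : U (y @^-1` `[0, T]) by [].
  rewrite (_ : _ @^-1` _ = setT); first exact: filterT.
  by apply/seteqP; split => // k _ /=; rewrite in_itv/= y0T.
by exists l.
Qed.

Definition cube_lipschitz (I : finType) (f : (I -> R) -> R) (C : R) :=
  forall (x y : I -> R) (e : R), (forall i, 0 <= x i <= 1) -> (forall i, 0 <= y i <= 1) ->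
    (forall i, `|x i - y i| <= e) -> `|f x - f y| <= C * e.

(** Compactness of measures on the cube, with the limit realized as the law of a
    random point [X] of the cube.  The masses of digit prefixes converge along an
    ultrafilter to an additive tree [M]; [X] has the digits of the address in [M].
    Cutting points after [h] digits moves them by at most [2 ^- h], and the integral
    of a function of finitely many digits is a finite combination of masses, so the
    integrals of Lipschitz functions pass to the limit. *)
Theorem weak_limit (I : finType) (J : nat -> finType) (w : forall k, J k -> R)
    (x : forall k, J k -> I -> R) (T : R) :
  (forall k j, 0 <= w k j) -> (forall k, \sum_j w k j = T) ->
  (forall k j i, 0 <= x k j i <= 1) ->
  exists (nu : {measure set (measurableTypeR R) -> \bar R}) (X : R -> I -> R),
    [/\ (nu setT < +oo)%E,
        forall i, measurable_fun setT (X ^~ i),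
        forall t i, 0 <= X t i <= 1 &
        forall f C c, cube_lipschitz f C ->
          (\sum_j w k j * f (x k j)) @[k --> \oo] --> c ->
          has_integral nu (fun t => f (X t)) c].
Proof.
move=> w_ge0 wT x01.
have T_ge0 : 0 <= T by rewrite -(wT 0%N) sumr_ge0.
have [U [UU ooU]] := ultraFilterLemma (@eventually_filter).
pose b k (j : J k) := point_bits (x k j).
pose mass k (s : seq bool) := \sum_j w k j * (bit_prefix (b k j) (size s) == s)%:R.
have mass_ge0 k s : 0 <= mass k s by rewrite sumr_ge0// => j _; rewrite mulr_ge0.
have massT k s : mass k s <= T.
  by rewrite -(wT k) ler_sum// => j _; rewrite ler_piMr//; case: (_ == _).
have massD k s : mass k s = mass k (false :: s) + mass k (true :: s).
  rewrite -big_split; apply: eq_bigr => j _ /=; rewrite -mulrDr !eqseq_cons.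
  by case: (b k j _); rewrite /= ?(addr0, add0r).
have /choice[M MU] : forall s, exists l : R, mass ^~ s @ U --> l.
  by move=> s; apply: (@ultra_bounded_cvg _ _ T) => k; rewrite mass_ge0 massT.
have M_ge0 s : 0 <= M s.
  by apply: (cvgr_to_ge (MU s)); apply: nearW => k; exact: mass_ge0.
have MD s : M s = M (false :: s) + M (true :: s).
  have cD : mass ^~ s @ U --> M (false :: s) + M (true :: s).
    rewrite (_ : mass ^~ s = (fun k => mass k (false :: s) + mass k (true :: s))).
      exact: cvgD.
    by apply/funext => k; exact: massD.
  exact: (cvg_unique _ (MU s) cD).
pose beta (t : R) h := head false (address M h.+1 t).
have addressE t h : address M h t = bit_prefix (beta t) h.
  by elim: h => // h IHh; rewrite [RHS]/= -IHh.
have nufin : (tree_measure M setT < +oo)%E by rewrite tree_measureT ?ltry.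
exists (tree_measure M), (fun t => bit_limit (beta t)).
have mX (i : I) : measurable_fun setT (fun t : R => bit_limit (beta t) i : R).
  apply: (@measurable_fun_cvg _ _ _ setT
    (fun h t => bit_sum (bit_of (address M (depth I h) t)) i h)) => [h|t _].
    exact: (measurable_fun_address M_ge0 MD (depth I h)
      (fun s => bit_sum (bit_of s) i h)).
  apply: cvg_trans (cvg_bit_sum (beta t) i); apply: near_eq_cvg.
  by apply: nearW => h; rewrite addressE bit_sum_prefix.
split; [exact: nufin | exact: mX | by move=> t i; exact: bit_limit_itv |].
move=> f C c fC fc.
(* [F h s]: the value of [f] at the point given by the first [h] digits read in [s];
   [a h] is the integral of the corresponding function on the line. *)
pose F h (s : seq bool) := f (fun i => bit_sum (bit_of s) i h).
have bs01 d h (i : I) : 0 <= (bit_sum d i h : R) <= 1 by exact: bit_sum_itv.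
pose a h := \sum_(s : (depth I h).-tuple bool) F h s * M s.
have Fa h : has_integral (tree_measure M) (fun t => F h (address M (depth I h) t)) (a h).
  exact: has_integral_address.
have FE h d : F h (bit_prefix d (depth I h)) = f (fun i => bit_sum d i h).
  by congr f; apply/funext => i; rewrite bit_sum_prefix.
have e0 : (fun h => C * 2 ^- h) @ \oo --> (0 : R).
  rewrite -(mulr0 C); apply: cvgMr.
  under eq_fun do rewrite -exprVn.
  by apply: cvg_expr; rewrite ger0_norm ?invr_ge0// invf_lt1// ltr1n.
have fX t : (fun h => F h (address M (depth I h) t)) @ \oo --> f (bit_limit (beta t)).
  apply/cvgrPdist_le => e e_gt0; move/cvgrPdist_le/(_ e e_gt0): e0.
  apply: filterS => h; rewrite sub0r normrN => he.
  rewrite addressE FE (le_trans _ (le_trans (ler_norm _) he))//.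
  apply: fC => // i; first exact: bit_limit_itv.
  have /andP[l1 l2] := bit_limit_near R (beta t) i h.
  by rewrite ger0_norm ?subr_ge0// lerBlDl; exact: l2.
have C_ge0 : 0 <= C.
  have := fC (fun=> 0) (fun=> 0) 1; rewrite !subrr !normr0 mulr1.
  by apply=> i; rewrite ?lexx ler01.
pose B := `|f (fun=> 0)| + C.
have FB h s : `|F h s| <= B.
  rewrite -[F h s](subrK (f (fun=> 0))) addrC (le_trans (ler_normD _ _))//.
  rewrite lerD2l -[C]mulr1; apply: fC => // i; first by rewrite lexx ler01.
  by have := bs01 (bit_of s) h i; rewrite subr0 ler_norml; lra.
have [c' Ic' ac'] := has_integral_lim Fa fX (has_integral_cst B nufin) (fun h t => FB h _).
suff -> : c = c' by [].
apply: (cvg_unique _ _ ac') => //; apply/cvgrPdist_le => e e_gt0.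
have eT0 : (fun h => T * (C * 2 ^- h)) @ \oo --> (0 : R).
  by rewrite -(mulr0 T); exact: cvgMr.
move/cvgrPdist_le/(_ e e_gt0): eT0; apply: filterS => h.
rewrite sub0r normrN => he; apply: le_trans (le_trans (ler_norm _) he).
(* Before the limit in [k], the sum over prefixes is a sum over the nodes cut after
   [h] digits. *)
have cU : `|(\sum_j w k j * f (x k j)) - \sum_(s : (depth I h).-tuple bool) F h s * mass k s|
    @[k --> U] --> `|c - a h|.
  apply: cvg_norm; apply: cvgB; first by apply: cvg_trans fc; exact: cvg_app.
  by apply: cvg_big => [| s _]; [exact: add_continuous | exact: cvgMr].
apply: (cvgr_to_le cU); apply: nearW => k.
have -> : \sum_(s : (depth I h).-tuple bool) F h s * mass k s
    = \sum_j w k j * F h (bit_prefix (b k j) (depth I h)).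
  under eq_bigr do rewrite mulr_sumr.
  rewrite exchange_big; apply: eq_bigr => j _ /=.
  rewrite (bigD1 (Tuple (introT eqP (size_bit_prefix (b k j) (depth I h)))))//=.
  rewrite [X in _ + X]big1 => [|s]; first by rewrite addr0 size_bit_prefix eqxx mulr1 mulrC.
  by rewrite -val_eqE/= eq_sym size_tuple => /negbTE ->; rewrite !mulr0.
rewrite -sumrB (le_trans (ler_norm_sum _ _ _))// -(wT k) mulr_suml ler_sum// => j _.
rewrite -mulrBr normrM ger0_norm// ler_wpM2l// FE.
by apply: fC => // i; exact: point_bits_near.
Qed.

End WeakLimit.

(** * The cone of a linear form nonnegative on squares *)

Section GeometricSumRing.
Variable A : nzRingType.

Definition geometric_sum (x : A) k : A := \sum_(i < k) (1 - x) ^+ i.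

Lemma geometric_sumE x k : x * geometric_sum x k = 1 - (1 - x) ^+ k.
Proof.
rewrite /geometric_sum -[1 - _ ^+ k]opprB -{1}(subKr 1 x) -opprB mulNr -subrX1.
by rewrite !opprB.
Qed.

End GeometricSumRing.

Section PositiveCone.
Variables (R : realType) (A : comAlgType R) (L : {scalar A}).
Implicit Types (x y g h : A) (C D : R).

(** Since [cone] asks for multiplication to preserve the positive elements, it is closed
    under products, which the set of positive elements need not be. *)
Definition positive g := forall h, 0 <= L (g * h ^+ 2).
Definition cone x := forall g, positive g -> positive (x * g).
(** Equality modulo the largest ideal contained in the kernel of [L]; it replaces
    computation in the quotient ring. *)
Definition equiv x y := forall h, L (x * h) = L (y * h).

Lemma cone_equiv x y : equiv x y -> cone x -> cone y.
Proof. by move=> xy Cx g Pg h; rewrite -mulrA -xy mulrA; exact: Cx. Qed.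

Lemma coneM x y : cone x -> cone y -> cone (x * y).
Proof. by move=> Cx Cy g Pg; rewrite -mulrA; apply/Cx/Cy. Qed.

Lemma coneD x y : cone x -> cone y -> cone (x + y).
Proof.
move=> Cx Cy g Pg h; rewrite mulrDl mulrDl raddfD addr_ge0//; [exact: Cx|exact: Cy].
Qed.

Lemma coneZ k x : 0 <= k -> cone x -> cone (k *: x).
Proof.
by move=> k0 Cx g Pg h; rewrite -scalerAl -scalerAl linearZ/= mulr_ge0//; exact: Cx.
Qed.

Lemma cone_sqr x : cone (x ^+ 2).
Proof. by move=> g Pg h; rewrite (mulrC (x ^+ 2)) -mulrA -exprMn. Qed.

Lemma cone1 : cone 1.
Proof. by rewrite -(expr1n _ 2); exact: cone_sqr. Qed.

Lemma cone0 : cone 0.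
Proof. by have := cone_sqr 0; rewrite expr0n. Qed.

Lemma coneX x k : cone x -> cone (x ^+ k).
Proof.
move=> Cx; elim: k => [|k IHk]; first by rewrite expr0; exact: cone1.
by rewrite exprS; exact: coneM.
Qed.

Lemma cone_sum I (r : seq I) (P : pred I) (F : I -> A) :
  (forall i, P i -> cone (F i)) -> cone (\sum_(i <- r | P i) F i).
Proof. by move=> CF; elim/big_ind : _ => //; [exact: cone0|exact: coneD]. Qed.

Lemma cone_prod I (r : seq I) (P : pred I) (F : I -> A) :
  (forall i, P i -> cone (F i)) -> cone (\prod_(i <- r | P i) F i).
Proof. by move=> CF; elim/big_ind : _ => //; [exact: cone1|exact: coneM]. Qed.

Lemma coneMn x k : cone x -> cone (x *+ k).
Proof. by move=> Cx; rewrite -scaler_nat; exact: coneZ. Qed.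

Hypothesis L_sqr_ge0 : positive 1.

Lemma cone_ge0 x : cone x -> 0 <= L x.
Proof. by move=> /(_ 1 L_sqr_ge0 1); rewrite expr1n !mulr1. Qed.

Lemma cone_le x y : cone (y - x) -> L x <= L y.
Proof. by move=> /cone_ge0; rewrite raddfB subr_ge0. Qed.

Definition bounded_by (C : R) x := cone (C%:A + x) /\ cone (C%:A - x).

Lemma cone_half x : cone (x + x) -> cone x.
Proof.
move=> /(coneZ (k := 2^-1)); rewrite invr_ge0 ler0n => /(_ isT).
by rewrite scalerDr -scalerDl -mulr2n -[2^-1 *+ 2]mulr_natr mulVf ?pnatr_eq0// scale1r.
Qed.

(** Twice [C D + x y] is [(C + x) (D + y) + (C - x) (D - y)]. *)
Lemma bounded_byM C D x y : bounded_by C x -> bounded_by D y -> bounded_by (C * D) (x * y).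
Proof.
have CDA : (C * D)%:A = C%:A * D%:A :> A by rewrite -scalerAl mul1r scalerA.
move=> [Cx Cx'] [Dy Dy']; split; apply: cone_half; rewrite CDA.
  rewrite (_ : _ + _ = (C%:A + x) * (D%:A + y) + (C%:A - x) * (D%:A - y)).
    by apply: coneD; exact: coneM.
  by ring.
rewrite (_ : _ + _ = (C%:A + x) * (D%:A - y) + (C%:A - x) * (D%:A + y)).
  by apply: coneD; exact: coneM.
by ring.
Qed.

Lemma bounded_byD C D x y : bounded_by C x -> bounded_by D y -> bounded_by (C + D) (x + y).
Proof.
move=> [Cx Cx'] [Dy Dy']; split; rewrite scalerDl.
  by rewrite addrACA; exact: coneD.
by rewrite opprD addrACA; exact: coneD.
Qed.

Lemma cone_scalar (C : R) : 0 <= C -> cone C%:A.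
Proof. by move=> C0; apply: coneZ => //; exact: cone1. Qed.

Lemma bounded_by_scalar (C : R) : bounded_by `|C| C%:A.
Proof.
split; rewrite -?scalerDl -?scalerBl; apply: cone_scalar.
  by rewrite -[C in _ + C]opprK subr_ge0 (le_trans (ler_norm _))// normrN.
by rewrite subr_ge0 ler_norm.
Qed.

Lemma bounded_by_itv x : cone x -> cone (1 - x) -> bounded_by 1 x.
Proof. by move=> Cx Cx'; split; rewrite scale1r//; apply: coneD => //; exact: cone1. Qed.

Lemma bounded_by_le C x y : bounded_by C x -> cone y -> `|L (y * x)| <= C * L y.
Proof.
move=> [Cx Cx'] Cy; rewrite ler_norml -subr_ge0 -[X in _ && X]subr_ge0.
have EC : L (y * C%:A) = C * L y by rewrite -scalerAr mulr1 scalarZ.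
have := cone_ge0 (coneM Cy Cx); rewrite mulrDr raddfD /= EC => ?.
have := cone_ge0 (coneM Cy Cx'); rewrite mulrBr raddfB /= EC => ?.
by apply/andP; split; lra.
Qed.

Section Localization.
Variables theta rho : A.
Hypothesis thetarho : equiv (theta * rho) 1.
Hypothesis cone_rho : cone rho.
Hypothesis cone_rho1 : cone (rho - 1).

(** Modulo [theta * rho = 1], [theta * x] is [theta ^+ 2 * (rho * x)]. *)
Lemma cone_theta_mul x : cone x -> cone (theta * x).
Proof.
move=> Cx; apply: (@cone_equiv (theta ^+ 2 * (rho * x))).
  by move=> h; rewrite -[theta * x * h]mul1r -thetarho; congr (L _); ring.
by apply: coneM; [exact: cone_sqr | exact: coneM].
Qed.

Lemma cone_theta : cone theta.
Proof. by rewrite -[theta]mulr1; apply: cone_theta_mul; exact: cone1. Qed.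

(** [1 - theta] is [theta * (rho - 1)]. *)
Lemma cone_1theta : cone (1 - theta).
Proof.
apply: (@cone_equiv (theta * (rho - 1))); last exact: cone_theta_mul.
by move=> h; rewrite mulrBr mulr1 !mulrBl !raddfB /= thetarho.
Qed.

Lemma cone_geom k : cone (geometric_sum theta k).
Proof. by apply: cone_sum => i _; exact/coneX/cone_1theta. Qed.

(** The geometric sums of ratio [1 - theta] approach [1 / theta = rho] from below,
    with an explicit error. *)
Lemma rho_geom k : equiv (rho - geometric_sum theta k) (rho * (1 - theta) ^+ k).
Proof.
move=> h; rewrite -[LHS](addrK (L (theta * rho * (geometric_sum theta k * h)))).
rewrite {1}thetarho mul1r.
rewrite (_ : theta * rho * _ = rho * h - rho * (1 - theta) ^+ k * h).
  by rewrite -[geometric_sum theta k * h]mulrC mulrBl !raddfB /= (mulrC h); ring.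
rewrite mulrC [geometric_sum theta k * h]mulrC -!mulrA; transitivity (h * rho * (theta * geometric_sum theta k)).
  by ring.
by rewrite geometric_sumE; ring.
Qed.

Lemma cone_rho_geom k : cone (rho - geometric_sum theta k).
Proof.
apply: (@cone_equiv (rho * (1 - theta) ^+ k)); first by move=> h; rewrite rho_geom.
by apply: coneM => //; exact/coneX/cone_1theta.
Qed.

(** The inequality (k + 1) x (1 - x)^k <= 1 on [0, 1], in algebraic form:
    x sum_(i <= k) (1 - x)^i <= 1, and each of the k + 1 terms is at least the last. *)
Lemma cone_tail_bound k : cone (1 - (theta * (1 - theta) ^+ k) *+ k.+1).
Proof.
rewrite (_ : 1 - _ = (1 - theta) ^+ k.+1 +
  theta * \sum_(i < k.+1) ((1 - theta) ^+ i - (1 - theta) ^+ k)).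
  apply: coneD; first exact/coneX/cone_1theta.
  apply: cone_theta_mul; apply: cone_sum => i _.
  rewrite -{2}(subnKC (ltn_ord i : (i <= k)%N)) exprD -{1}[_ ^+ i]mulr1 -mulrBr.
  apply: coneM; first exact/coneX/cone_1theta.
  by rewrite -geometric_sumE; apply: cone_theta_mul; exact: cone_geom.
rewrite sumrB sumr_const card_ord mulrBr -/(geometric_sum theta k.+1) geometric_sumE mulrnAr.
by ring.
Qed.

Lemma tail_le M k : L (rho ^+ M * (1 - theta) ^+ k) <= L (rho ^+ M.+1) / k.+1%:R.
Proof.
rewrite ler_pdivlMr ?ltr0Sn// mulr_natr -raddfMn /=.
have -> : L (rho ^+ M * (1 - theta) ^+ k *+ k.+1) =
    L (rho ^+ M.+1 * ((theta * (1 - theta) ^+ k) *+ k.+1)).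
  rewrite -[_ *+ k.+1 in LHS]mul1r -thetarho; congr (L _).
  by rewrite exprS -!mulrnAr; ring.
apply: cone_le; rewrite -{1}[rho ^+ M.+1]mulr1 -mulrBr.
by apply: coneM; [exact: coneX | exact: cone_tail_bound].
Qed.

(** [rho ^+ M.+1 - rho ^+ M * geometric_sum theta k] is [rho ^+ M.+1 * (1 - theta) ^+ k],
    so on elements with a bound the error is controlled by [tail_le]. *)
Lemma cvg_tail M C x : 0 <= C -> bounded_by C x ->
  L (rho ^+ M * geometric_sum theta k * x) @[k --> \oo] --> L (rho ^+ M.+1 * x).
Proof.
move=> C0 Cx; apply/cvgrPdist_le => e e_gt0.
have c0 : (fun k => C * (L (rho ^+ M.+2) / k.+1%:R)) @ \oo --> (0 : R).
  rewrite -(mulr0 C); apply: cvgMr; rewrite -(mulr0 (L (rho ^+ M.+2))).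
  by apply: cvgMr; exact: cvg_harmonic.
move/cvgrPdist_le/(_ e e_gt0): c0; apply: filterS => k.
rewrite sub0r normrN => /(le_trans (ler_norm _)); apply: le_trans.
have -> : L (rho ^+ M.+1 * x) - L (rho ^+ M * geometric_sum theta k * x)
    = L (rho ^+ M.+1 * (1 - theta) ^+ k * x).
  rewrite -raddfB /=.
  have -> : rho ^+ M.+1 * x - rho ^+ M * geometric_sum theta k * x = (rho - geometric_sum theta k) * (rho ^+ M * x).
    by rewrite exprS; ring.
  by rewrite rho_geom; congr (L _); rewrite exprS; ring.
have Cr : cone (rho ^+ M.+1 * (1 - theta) ^+ k).
  by apply: coneM; apply: coneX => //; exact: cone_1theta.
apply: le_trans (bounded_by_le Cx Cr) _.
by rewrite ler_wpM2l// tail_le.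
Qed.

End Localization.

End PositiveCone.

(** * The Hausdorff moment problem *)

Section Bernstein.
Variable A : comNzRingType.

Definition bernstein k j (x : A) : A := (x ^+ j * (1 - x) ^+ (k - j)) *+ 'C(k, j).

(** The falling factorial moments of the binomial law: for them, unlike for powers,
    the Bernstein sums are exact.  Induction on [r] by
    (k + 1) C(k, j) = (j + 1) C(k + 1, j + 1). *)
Lemma sum_bernstein_ffact r k (x : A) :
  \sum_(j < k.+1) bernstein k j x *+ (j ^_ r) = x ^+ r *+ (k ^_ r).
Proof.
elim: r k => [|r IHr] k.
  rewrite [RHS](_ : _ = ((1 - x) + x) ^+ k); last first.
    by rewrite subrK expr1n expr0 ffactn0.
  rewrite exprDn; apply: eq_bigr => j _; rewrite ffactn0 mulr1n /bernstein.
  by congr (_ *+ _); rewrite mulrC.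
case: k => [|k].
  by rewrite big_ord_recl big_ord0 addr0 !ffact0n.
rewrite big_ord_recl ffact0n mulr0n add0r ffactSS mulnC mulrnA exprS -mulrnAr -IHr.
rewrite mulr_sumr -sumrMnl; apply: eq_bigr => j _.
rewrite /bernstein lift0 ffactSS exprS subSS -!mulrnAr -!mulrA -!mulrnA.
by congr (_ * (_ * (_ *+ _))); have := mul_bin_diag k.+1 j => /=; nia.
Qed.

End Bernstein.

Section FallingFactorial.
Variable R : realFieldType.

Lemma leq_ffact (k j r : nat) : (j <= k)%N -> (j ^_ r <= k ^_ r)%N.
Proof.
move=> jk; elim: r => [|r IHr]; first by rewrite !ffactn0.
by rewrite !ffactnSr leq_mul// leq_sub2r.
Qed.

Lemma ffact_ratio_itv (k j r : nat) : (j <= k)%N ->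
  0 <= ((j ^_ r)%:R / (k ^_ r)%:R : R) <= 1.
Proof.
move=> jk; rewrite divr_ge0//=.
have [k0|k0] := posnP (k ^_ r); first by rewrite k0 invr0 mulr0.
by rewrite ler_pdivrMr ?ltr0n// mul1r ler_nat; exact: leq_ffact.
Qed.

(** Passing from [r] to [r + 1] multiplies the two sides by j / k and (j - r) / (k - r),
    which differ by at most r / k; when j < r the falling factorial is already 0. *)
Lemma ffact_ratio_near (k j r : nat) : (j <= k)%N -> (r <= k)%N -> 
  `|(j%:R / k%:R) ^+ r - (j ^_ r)%:R / (k ^_ r)%:R| <= (r * r)%:R / k%:R :> R.
Proof.
move=> jk; elim: r => [|r IHr] rk.
  by rewrite expr0 !ffactn0 divr1 subrr normr0 divr_ge0.
have k_gt0 : 0 < k%:R :> R by rewrite ltr0n; exact: leq_ltn_trans rk.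
have kr_gt0 : 0 < (k - r)%:R :> R by rewrite ltr0n subn_gt0.
set y := j%:R / k%:R.
have y01 : 0 <= y <= 1 by rewrite divr_ge0//= ler_pdivrMr// mul1r ler_nat.
set b := (j ^_ r)%:R / (k ^_ r)%:R in IHr.
have b01 : 0 <= b <= 1 by exact: ffact_ratio_itv.
have -> : (j ^_ r.+1)%:R / (k ^_ r.+1)%:R = b * ((j - r)%:R / (k - r)%:R) :> R.
  by rewrite !ffactnSr !natrM invfM /b mulrACA.
rewrite exprS (_ : _ - _ = y * (y ^+ r - b) + b * (y - (j - r)%:R / (k - r)%:R)); last by ring.
apply: le_trans (ler_normD _ _) _; rewrite (normrM y) (normrM b).
have r1 : (r * r)%:R / k%:R + r%:R / k%:R <= (r.+1 * r.+1)%:R / k%:R :> R.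
  by rewrite -mulrDl ler_pM2r ?invr_gt0// -natrD ler_nat; lia.
apply: le_trans r1; apply: lerD.
  have /andP[y0 y1] := y01; rewrite (ger0_norm y0).
  apply: le_trans (ler_piMl _ y1) _ => //; exact/IHr/ltnW.
have /andP[b0 b1] := b01; rewrite (ger0_norm b0).
have [jr|rj] := ltnP j r.
  by rewrite /b ffact_small// mul0r mul0r divr_ge0.
apply: le_trans (ler_piMl _ b1) _ => //.
rewrite (_ : y - _ = (r%:R / k%:R) * ((k%:R - j%:R) / (k - r)%:R)); last first.
  rewrite /y !natrB ?(ltnW rk)//; field.
  by rewrite -natrB ?(ltnW rk)// !gt_eqF.
rewrite normrM ger0_norm ?divr_ge0// ler_piMr ?divr_ge0//.
rewrite ger0_norm ?divr_ge0 ?subr_ge0 ?ler_nat//.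
by rewrite ler_pdivrMr// mul1r -natrB// ler_nat leq_sub2l.
Qed.

Lemma prod_unit_near (I : finType) (x y e : I -> R) :
  (forall i, 0 <= x i <= 1) -> (forall i, 0 <= y i <= 1) ->
  (forall i, `|x i - y i| <= e i) ->
  `|\prod_i x i - \prod_i y i| <= \sum_i e i.
Proof.
move=> x01 y01 xy.
pose K (a b c : R) := [/\ 0 <= a <= 1, 0 <= b <= 1 & `|a - b| <= c].
suff [] : K (\prod_i x i) (\prod_i y i) (\sum_i e i) by [].
apply: (big_ind3 K) => [|a b c a' b' c' [a01 b01 ab] [a01' b01' ab']|i _].
- by split; rewrite ?ler01 ?lexx// subrr normr0.
- have /andP[a0 a1] := a01; have /andP[b0 b1] := b01.
  have /andP[a0' a1'] := a01'; have /andP[b0' b1'] := b01'.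
  split; rewrite ?mulr_ge0 ?mulr_ile1//.
  rewrite (_ : _ - _ = a' * (a - b) + b * (a' - b')); last by ring.
  apply: le_trans (ler_normD _ _) _; rewrite !normrM (ger0_norm a0') (ger0_norm b0).
  by apply: lerD; [apply: le_trans ab | apply: le_trans ab']; exact: ler_piMl.
- by split.
Qed.

End FallingFactorial.

Section Hausdorff.
Variables (R : realType) (A : comAlgType R) (L : {scalar A}).
Hypothesis L_sqr_ge0 : positive L 1.
Variables (I : finType) (u : I -> A).
Hypothesis cone_u : forall i, cone L (u i).
Hypothesis cone_1u : forall i, cone L (1 - u i).

Lemma cube_lipschitz_monomial (r : I -> nat) :
  cube_lipschitz (fun x : I -> R => \prod_i x i ^+ r i) (\sum_i r i)%:R.
Proof.
move=> x y e x01 y01 xy; rewrite natr_sum mulr_suml.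
have pow01 (z : R) q : 0 <= z <= 1 -> 0 <= z ^+ q <= 1.
  by move=> /andP[z0 z1]; rewrite exprn_ge0// exprn_ile1.
apply: prod_unit_near => i; [exact: pow01|exact: pow01|].
apply: le_trans (_ : `|x i - y i| *+ r i <= _); last first.
  by rewrite -(mulr_natl `|x i - y i|) ler_wpM2l.
have /andP[x0 x1] := x01 i; have /andP[y0 y1] := y01 i.
elim: (r i) => [|q IHq]; first by rewrite !expr0 subrr normr0.
rewrite !exprS (_ : _ - _ = x i * (x i ^+ q - y i ^+ q) + y i ^+ q * (x i - y i)); last by ring.
apply: le_trans (ler_normD _ _) _; rewrite mulrSr !normrM (ger0_norm x0).
have /andP[q0 q1] := pow01 _ q (y01 i); rewrite (ger0_norm q0).
by apply: lerD; [apply: le_trans IHq|]; exact: ler_piMl.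
Qed.

(** The mass, under the discrete approximation of mesh [1/k], of the grid point
    [bernstein_node j]. *)
Definition bernstein_weight k (j : {ffun I -> 'I_k.+1}) : R :=
  L (\prod_i bernstein k (j i) (u i)).

Definition bernstein_node k (j : {ffun I -> 'I_k.+1}) (i : I) : R := (j i)%:R / k%:R.

Lemma bernstein_weight_ge0 k j : 0 <= bernstein_weight (k := k) j.
Proof.
apply: cone_ge0 => //; apply: cone_prod => i _; apply: coneMn; apply: coneM.
  exact: coneX.
exact: coneX.
Qed.

Lemma bernstein_moment k (r : I -> nat) :
  \sum_j bernstein_weight (k := k) j * (\prod_i ((j i) ^_ (r i))%:R)
  = (\prod_i (k ^_ (r i))%:R) * L (\prod_i u i ^+ r i).
Proof.
have -> : (\prod_i (k ^_ (r i))%:R) * L (\prod_i u i ^+ r i)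
    = L (\prod_i (u i ^+ r i *+ (k ^_ (r i)))).
  rewrite -scalarZ; congr (L _); rewrite -mulr_algl.
  under [RHS]eq_bigr do rewrite -mulr_natl.
  rewrite big_split; congr (_ * _).
  by rewrite -[_%:A]/(in_alg A _) rmorph_prod; apply: eq_bigr => i _; rewrite rmorph_nat.
under [in RHS]eq_bigr do rewrite -sum_bernstein_ffact.
rewrite bigA_distr_bigA raddf_sum; apply: eq_bigr => j _ /=.
rewrite mulrC -scalarZ; congr (L _); rewrite -mulr_algl.
under [RHS]eq_bigr do rewrite -mulr_natl.
rewrite big_split; congr (_ * _).
by rewrite -[_%:A]/(in_alg A _) rmorph_prod; apply: eq_bigr => i _; rewrite rmorph_nat.
Qed.

Lemma sum_bernstein_weight k : \sum_j bernstein_weight (k := k) j = L 1.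
Proof.
have E (f : I -> nat) : \prod_i (f i ^_ 0)%:R = 1 :> R.
  by rewrite big1// => i _; rewrite ffactn0.
have <- : (\prod_(i : I) (k ^_ 0)%:R) * L (\prod_i u i ^+ 0) = L 1.
  rewrite [X in L X]big1 => [|i _]; last by rewrite expr0.
  by rewrite [X in X * _](E (fun=> k)) mul1r.
rewrite -(bernstein_moment k (fun=> 0%N)).
by apply: eq_bigr => j _; rewrite [X in _ * X]E mulr1.
Qed.

Lemma cvg_bernstein_moment (r : I -> nat) :
  (\sum_j bernstein_weight (k := k) j * \prod_i bernstein_node j i ^+ r i)
     @[k --> \oo] --> L (\prod_i u i ^+ r i).
Proof.
have L1 : 0 <= L 1 by apply: cone_ge0 => //; exact: cone1.
pose C : R := \sum_i (r i * r i)%:R.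
have e0 : (fun k => L 1 * (C / k.+1%:R)) @ \oo --> (0 : R).
  rewrite -(mulr0 (L 1)); apply: cvgMr; rewrite -(mulr0 C).
  by apply: cvgMr; exact: cvg_harmonic.
(* Shift [k] by one: [bernstein_node] divides by [k]. *)
rewrite -cvg_shiftS; apply/cvgrPdist_le => e e_gt0.
move/cvgrPdist_le/(_ e e_gt0): e0 => e0.
near=> k; have : L 1 * (C / k.+1%:R) <= e.
  apply: le_trans (ler_norm _) _; rewrite -normrN -sub0r; near: k; exact: e0.
apply: le_trans; set K := k.+1.
have rK i : (r i <= K)%N.
  apply: leq_trans (leq_bigmax i) _; apply: leqW; near: k.
  by exists (\max_i r i)%N.
have prodK : \prod_i (K ^_ (r i))%:R != 0 :> R.
  by apply/prodf_neq0 => i _; rewrite pnatr_eq0 -lt0n ffact_gt0.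
have -> : L (\prod_i u i ^+ r i) = \sum_j bernstein_weight (k := K) j *
    \prod_i ((j i ^_ r i)%:R / (K ^_ r i)%:R).
  apply: (mulfI prodK); rewrite -bernstein_moment mulr_sumr; apply: eq_bigr => j _.
  rewrite mulrCA -big_split; congr (_ * _); apply: eq_bigr => i _ /=.
  by rewrite mulrC divfK// pnatr_eq0 -lt0n ffact_gt0.
rewrite -sumrB; apply: le_trans (ler_norm_sum _ _ _) _.
rewrite -(sum_bernstein_weight K) mulr_suml; apply: ler_sum => j _.
rewrite -mulrBr normrM (ger0_norm (bernstein_weight_ge0 j)).
apply: ler_wpM2l; first exact: bernstein_weight_ge0.
have jK i : (j i <= K)%N by rewrite -ltnS ltn_ord.
have node01 i : 0 <= bernstein_node j i <= 1.
  by rewrite divr_ge0//= ler_pdivrMr ?ltr0Sn// mul1r ler_nat.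
rewrite distrC /C mulr_suml; apply: prod_unit_near => i.
- by have /andP[n0 n1] := node01 i; rewrite exprn_ge0// exprn_ile1.
- exact: ffact_ratio_itv.
- exact: ffact_ratio_near.
Unshelve. all: by end_near. Qed.

(** The measure is the [weak_limit] of the Bernstein weights; monomials are Lipschitz on
    the cube, so their integrals are the limits of the discrete moments. *)
Theorem hausdorff_moments :
  exists (nu : {measure set (measurableTypeR R) -> \bar R}) (X : R -> I -> R),
    [/\ (nu setT < +oo)%E,
        forall i, measurable_fun setT (X ^~ i),
        forall t i, 0 <= X t i <= 1 &
        forall r : I -> nat,
          has_integral nu (fun t => \prod_i X t i ^+ r i) (L (\prod_i u i ^+ r i))].
Proof.
have node01 k (j : {ffun I -> 'I_k.+1}) i : 0 <= bernstein_node j i <= 1.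
  rewrite /bernstein_node divr_ge0//=; case: k j => [|k] j; first by rewrite invr0 mulr0.
  by rewrite ler_pdivrMr ?ltr0Sn// mul1r ler_nat -ltnS ltn_ord.
have [nu [X [nufin mX X01 IX]]] := weak_limit bernstein_weight_ge0 sum_bernstein_weight node01.
exists nu, X; split => // r.
exact: (IX _ _ _ (cube_lipschitz_monomial r) (@cvg_bernstein_moment r)).
Qed.

End Hausdorff.

(** * From polynomials on the cube to integrals *)

Section Evaluation.
Variables (R : realType) (A : comAlgType R) (L : {scalar A}).
Variables (I : finType) (u : I -> A) (X : R -> I -> R).
Variable nu : {measure set (measurableTypeR R) -> \bar R}.
Hypothesis IX : forall r : I -> nat,
  has_integral nu (fun s => \prod_i X s i ^+ r i) (L (\prod_i u i ^+ r i)).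
Implicit Types (F G : R -> R) (a b : A).

(** Stability under multiplication is built into [evaluates], as it is in [cone]:
    this makes the pairs (function of [X], polynomial in [u]) closed under products
    without polynomial expressions in [u] being named. *)
Definition represents F a := forall r : I -> nat,
  has_integral nu (fun s => F s * \prod_i X s i ^+ r i) (L (a * \prod_i u i ^+ r i)).

Definition evaluates F a := forall G b,
  represents G b -> represents (fun s => F s * G s) (a * b).

Lemma represents1 : represents (fun=> 1) 1.
Proof. by move=> r; rewrite mul1r; apply: eq_has_integral (IX r) => s; rewrite mul1r. Qed.

Lemma evaluates_integral F a : evaluates F a -> has_integral nu F (L a).
Proof.
move=> /(_ _ _ represents1 (fun=> 0%N)); rewrite mulr1 big1 ?mulr1//.
by apply: eq_has_integral => s; rewrite mulr1 big1 ?mulr1.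
Qed.

Lemma evaluates1 : evaluates (fun=> 1) 1.
Proof.
by move=> G b Gb r; rewrite mul1r; apply: eq_has_integral (Gb r) => s; rewrite mul1r.
Qed.

Lemma evaluatesD F G a b : evaluates F a -> evaluates G b ->
  evaluates (fun s => F s + G s) (a + b).
Proof.
move=> Fa Gb H c Hc r; rewrite mulrDl mulrDl raddfD/=.
apply: eq_has_integral (has_integralD (Fa _ _ Hc r) (Gb _ _ Hc r)) => s.
by rewrite !mulrDl.
Qed.

Lemma evaluatesZ k F a : evaluates F a -> evaluates (fun s => k * F s) (k *: a).
Proof.
move=> Fa H c Hc r; rewrite -!scalerAl scalarZ.
by apply: eq_has_integral (has_integralZ k (Fa _ _ Hc r)) => s; rewrite !mulrA.
Qed.

Lemma evaluatesB F G a b : evaluates F a -> evaluates G b ->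
  evaluates (fun s => F s - G s) (a - b).
Proof.
move=> Fa /(evaluatesZ (-1)) Gb; have := evaluatesD Fa Gb.
rewrite scaleN1r; move=> H G' c Gc r; apply: eq_has_integral (H _ _ Gc r) => s.
by rewrite mulN1r.
Qed.

Lemma evaluatesM F G a b : evaluates F a -> evaluates G b ->
  evaluates (fun s => F s * G s) (a * b).
Proof.
move=> Fa Gb H c Hc r; rewrite -[a * b * c]mulrA.
by apply: eq_has_integral (Fa _ _ (Gb _ _ Hc) r) => s; rewrite !mulrA.
Qed.

Lemma evaluates_cst k : evaluates (fun=> k) k%:A.
Proof.
move=> G b Gb r; have := evaluatesZ k evaluates1 Gb r.
by apply: eq_has_integral => s; rewrite mulr1.
Qed.

Lemma evaluates_coord i : evaluates (X ^~ i) (u i).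
Proof.
move=> G b Gb r.
have prodS (B : comNzRingType) (x : I -> B) :
    \prod_k x k ^+ (r k + (k == i)) = x i * \prod_k x k ^+ r k.
  under eq_bigr do rewrite exprD.
  rewrite big_split/= [LHS]mulrC; congr (_ * _).
  rewrite (bigD1 i)//= eqxx expr1 big1 ?mulr1//.
  by move=> k /negbTE ->; rewrite expr0.
have := Gb (fun k => (r k + (k == i))%N); rewrite prodS mulrCA mulrA.
by apply: eq_has_integral => s; rewrite prodS mulrCA mulrA.
Qed.

(** The bound on the algebraic side controls the error under [L], the one on the
    side of functions serves for dominated convergence. *)
Definition bounded_evaluation F a :=
  evaluates F a /\ exists C : R, [/\ 0 <= C, forall s, `|F s| <= C & bounded_by L C a].

Lemma bounded_evaluationM F G a b : bounded_evaluation F a -> bounded_evaluation G b ->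
  bounded_evaluation (fun s => F s * G s) (a * b).
Proof.
move=> [Fa [C [C0 FC Ca]]] [Gb [D [D0 GD Db]]]; split; first exact: evaluatesM.
exists (C * D); split; [exact: mulr_ge0| |exact: bounded_byM].
by move=> s; rewrite normrM ler_pM.
Qed.

Lemma bounded_evaluationD F G a b : bounded_evaluation F a -> bounded_evaluation G b ->
  bounded_evaluation (fun s => F s + G s) (a + b).
Proof.
move=> [Fa [C [C0 FC Ca]]] [Gb [D [D0 GD Db]]]; split; first exact: evaluatesD.
exists (C + D); split; [exact: addr_ge0| |exact: bounded_byD].
by move=> s; rewrite (le_trans (ler_normD _ _))// lerD.
Qed.

Lemma bounded_evaluation_cst k : bounded_evaluation (fun=> k) k%:A.
Proof.
by split; [exact: evaluates_cst|exists `|k|; split => //; exact: bounded_by_scalar].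
Qed.

Lemma eq_bounded_evaluation F G a b : F =1 G -> a = b -> bounded_evaluation F a ->
  bounded_evaluation G b.
Proof. by move=> /funext -> ->. Qed.

Lemma bounded_evaluationX F a k : bounded_evaluation F a ->
  bounded_evaluation (fun s => F s ^+ k) (a ^+ k).
Proof.
move=> Fa; elim: k => [|k IHk].
  by apply: eq_bounded_evaluation (bounded_evaluation_cst 1); rewrite ?scale1r.
by apply: eq_bounded_evaluation (bounded_evaluationM Fa IHk) => [s|]; rewrite exprS.
Qed.

Lemma bounded_evaluation_prod J (r : seq J) (F : J -> R -> R) (a : J -> A) :
  (forall j, bounded_evaluation (F j) (a j)) ->
  bounded_evaluation (fun s => \prod_(j <- r) F j s) (\prod_(j <- r) a j).
Proof.
move=> Fa; elim: r => [|j r IHr].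
  apply: eq_bounded_evaluation (bounded_evaluation_cst 1) => [s|].
    by rewrite big_nil.
  by rewrite big_nil scale1r.
by apply: eq_bounded_evaluation (bounded_evaluationM (Fa j) IHr) => [s|]; rewrite big_cons.
Qed.

Lemma bounded_evaluation_sum J (r : seq J) (F : J -> R -> R) (a : J -> A) :
  (forall j, bounded_evaluation (F j) (a j)) ->
  bounded_evaluation (fun s => \sum_(j <- r) F j s) (\sum_(j <- r) a j).
Proof.
move=> Fa; elim: r => [|j r IHr].
  apply: eq_bounded_evaluation (bounded_evaluation_cst 0) => [s|].
    by rewrite big_nil.
  by rewrite big_nil scale0r.
by apply: eq_bounded_evaluation (bounded_evaluationD (Fa j) IHr) => [s|]; rewrite big_cons.
Qed.

End Evaluation.

Section GeometricSum.
Variable R : realType.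
Implicit Type x : R.

Lemma geometric_sum_ge0 x k : 0 <= x <= 1 -> 0 <= geometric_sum x k.
Proof. by move=> x01; apply: sumr_ge0 => i _; rewrite exprn_ge0// subr_ge0; case/andP: x01. Qed.

Lemma nondecreasing_geometric_sum x : 0 <= x <= 1 -> {homo geometric_sum x : k l / (k <= l)%N >-> k <= l}.
Proof.
move=> x01; apply/nondecreasing_seqP => k.
by rewrite /geometric_sum big_ord_recr/= lerDl exprn_ge0// subr_ge0; case/andP: x01.
Qed.

Lemma geometric_sumV x k : 0 < x <= 1 -> geometric_sum x k = x^-1 * (1 - (1 - x) ^+ k).
Proof. by move=> /andP[x0 _]; rewrite -geometric_sumE mulKf// gt_eqF. Qed.

Lemma geometric_sum_le x k : 0 < x <= 1 -> geometric_sum x k <= x^-1.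
Proof.
move=> x01; rewrite geometric_sumV//; case/andP: x01 => x0 x1.
apply: ler_piMr; first by rewrite invr_ge0 ltW.
by rewrite lerBlDr lerDl exprn_ge0// subr_ge0.
Qed.

Lemma cvg_geometric_sum x : 0 < x <= 1 -> geometric_sum x @ \oo --> x^-1.
Proof.
move=> x01; rewrite (_ : geometric_sum x = fun k => x^-1 * (1 - (1 - x) ^+ k)); last first.
  by apply/funext => k; exact: geometric_sumV.
rewrite -[X in _ --> X]mulr1; apply: cvgMr.
rewrite -[X in _ --> X](subr0 1); apply: cvgB; first exact: cvg_cst.
by apply: cvg_expr; case/andP: x01 => ? ?; rewrite ger0_norm; lra.
Qed.

End GeometricSum.

(** * Representation of unbounded polynomials *)

Section Representation.
Variables (R : realType) (A : comAlgType R) (L : {scalar A}) (n : nat).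
Variables (t : 'I_n -> A) (theta q : A).
Hypothesis L_sqr_ge0 : positive L 1.
Hypothesis cone_q : cone L q.
Let rho : A := 1 + \sum_j t j ^+ 2 + q.
Hypothesis thetarho : equiv L (theta * rho) 1.

Let cone_rho1 : cone L (rho - 1).
Proof.
have -> : rho - 1 = \sum_j t j ^+ 2 + q by rewrite /rho; ring.
apply: coneD => //.
by apply: cone_sum => j _; exact: cone_sqr.
Qed.

Let cone_rho : cone L rho.
Proof. by rewrite -(subrK 1 rho); apply: coneD => //; exact: cone1. Qed.

(** Completing the square; [e] is 1 or -1. *)
Let cone_rho_shift j (e : A) : e ^+ 2 = 1 -> cone L (rho + (e * t j) *+ 2).
Proof.
move=> e2; rewrite (_ : _ + _ = (1 + e * t j) ^+ 2 + (\sum_(i | i != j) t i ^+ 2 + q)).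
  apply: coneD; first exact: cone_sqr.
  by apply: coneD => //; apply: cone_sum => i _; exact: cone_sqr.
have -> : (1 + e * t j) ^+ 2 = 1 + (e * t j) *+ 2 + e ^+ 2 * t j ^+ 2 by ring.
by rewrite e2 /rho (bigD1 j)//=; ring.
Qed.

Let cone_shift j (e : A) : e ^+ 2 = 1 -> cone L (1 + (e * (theta * t j)) *+ 2).
Proof.
move=> e2; apply: (@cone_equiv _ _ _ (theta * (rho + (e * t j) *+ 2))).
  move=> h; rewrite mulrDr mulrDl raddfD/= thetarho -raddfD/= -mulrDl.
  by congr (L ((_ + _) * _)); ring.
exact: (cone_theta_mul thetarho cone_rho (cone_rho_shift j e2)).
Qed.

(** Coordinates on the cube: [theta] at [None], [1/2 + theta t_j] at [Some j]. *)
Let u (i : option 'I_n) : A :=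
  if i is Some j then 2^-1 *: (1 + (theta * t j) *+ 2) else theta.

Let cone_u i : cone L (u i).
Proof.
case: i => [j|] /=; last exact: (cone_theta thetarho cone_rho).
by apply: coneZ; rewrite ?invr_ge0// -[theta * t j]mul1r; apply: cone_shift; rewrite expr1n.
Qed.

Let cone_1u i : cone L (1 - u i).
Proof.
case: i => [j|] /=; last exact: (cone_1theta thetarho cone_rho cone_rho1).
have -> : 1 - 2^-1 *: (1 + (theta * t j) *+ 2) = 2^-1 *: (1 + (- 1 * (theta * t j)) *+ 2).
  rewrite mulN1r mulNrn -{1}(scale1r (1 : A)) {1}(splitr (1 : R)) div1r.
  by rewrite scalerDl scalerBr scalerDr; ring.
by apply: coneZ; rewrite ?invr_ge0//; apply: cone_shift; rewrite sqrrN expr1n.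
Qed.

Let theta_tE j : theta * t j = u (Some j) - (2^-1)%:A.
Proof.
rewrite /= scalerDr addrAC subrr add0r -(scaler_nat 2 (theta * t j)) scalerA.
by rewrite mulVf ?scale1r ?pnatr_eq0.
Qed.

(** The coordinate of [theta] vanishes on a null set [Z]: there the geometric sum with
    [k] terms equals [k], whereas its integral is at most [L rho] for all [k].  The
    random point is then moved to have nonzero [theta] everywhere. *)
Lemma positive_representation :
  exists (nu : {measure set (measurableTypeR R) -> \bar R}) (X : R -> option 'I_n -> R),
    [/\ (nu setT < +oo)%E,
        forall i, measurable_fun setT (X ^~ i),
        forall s i, 0 <= X s i <= 1,
        forall s, 0 < X s None &
        forall r : option 'I_n -> nat,
          has_integral nu (fun s => \prod_i X s i ^+ r i) (L (\prod_i u i ^+ r i))].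
Proof.
have [nu [X [nufin mX X01 IX]]] := hausdorff_moments L_sqr_ge0 cone_u cone_1u.
pose Z := [set s | X s None = 0].
have mZ : measurable Z.
  rewrite (_ : Z = X^~ None @^-1` [set 0])//.
  by rewrite -[X in measurable X]setTI; apply: mX => //; exact: measurable_set1.
have nuZ_fin : nu Z \is a fin_num.
  by rewrite ge0_fin_numE//; apply: le_lt_trans nufin; apply: le_measure; rewrite ?inE.
have geomI k : has_integral nu (fun s => geometric_sum (X s None) k) (L (geometric_sum theta k)).
  apply: (evaluates_integral IX).
  apply: (bounded_evaluation_sum _ (fun i : 'I_k => _)).1 => i.
  apply: bounded_evaluationX; split.
    apply: evaluatesB; last exact: (evaluates_coord None).
    by have := @evaluates_cst _ _ L _ u X nu 1; rewrite scale1r.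
  exists 1; split => // [s|].
    by have /andP[? ?] := X01 s None; rewrite ger0_norm ?subr_ge0// lerBlDr lerDl.
  by apply: bounded_by_itv; rewrite ?subKr//; [exact: (cone_1u None)|exact: (cone_u None)].
have Zk k : k%:R * fine (nu Z) <= L rho.
  apply: (@le_trans _ _ (L (geometric_sum theta k))); last first.
    exact: (cone_le L_sqr_ge0 (cone_rho_geom thetarho cone_rho cone_rho1 k)).
  apply: (has_integral_le (has_integralZ k%:R (has_integral_indic nufin mZ)) (geomI k)) => s.
  rewrite indicE; have [/set_mem Zs|_] := boolP (s \in Z).
    rewrite mulr1 /geometric_sum Zs subr0; under eq_bigr do rewrite expr1n.
    by rewrite sumr_const card_ord.
  by rewrite mulr0 geometric_sum_ge0.
have nuZ0 : nu Z = 0%E.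
  apply/eqP; rewrite -(fineK nuZ_fin) eqe; apply/eqP/le_anti; rewrite fine_ge0// andbT.
  rewrite leNgt; apply/negP => nuZ_gt0.
  have := Zk (Num.bound (L rho / fine (nu Z))).
  have := archi_boundP (divr_ge0 (cone_ge0 L_sqr_ge0 cone_rho) (ltW nuZ_gt0)).
  by rewrite ltr_pdivrMr// => /lt_geF ->.
(* On [Z] any point of the cube with nonzero [theta] would do. *)
pose X' s i := if X s None == 0 then 1 else X s i.
have X'E (F : (option 'I_n -> R) -> R) : {ae nu, forall s, F (X s) = F (X' s)}.
  exists Z; split => // s /= XX'; apply: contrapT => Zs; apply: XX'; congr F.
  by apply/funext => i; rewrite /X'; case: eqP.
have mX' i : measurable_fun setT (X' ^~ i).
  apply: measurable_fun_ifT => //.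
  apply: (measurable_fun_bool true).
  rewrite (_ : _ @^-1` _ = Z) ?setTI//.
  by apply/seteqP; split => s /= => [/eqP|->]; rewrite ?eqxx.
exists nu, X'; split => //.
- by move=> s i; rewrite /X'; case: eqP => // _; rewrite ler01 lexx.
- move=> s; rewrite /X'; case: eqP => // /eqP Xs; rewrite lt_neqAle eq_sym Xs.
  by case/andP: (X01 s None).
move=> r; apply: has_integral_ae (X'E (fun x => \prod_i x i ^+ r i)) (IX r).
by apply: measurable_prod => i _; exact: (measurable_funX (r i) (mX' i)).
Qed.

(** Under the relation, [prod_j t_j ^ alpha_j * theta ^ beta] is [rho ^ M] times a
    polynomial in [u], where [M] is the sum of the [alpha_j].  Integration of
    [rho ^ M] times a bounded polynomial is obtained by induction on [M], replacing
    one factor [rho] by its increasing polynomial approximations. *)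
Theorem unbounded_representation :
  exists (nu : {measure set (measurableTypeR R) -> \bar R})
    (T : R -> 'I_n -> R) (Theta : R -> R),
    [/\ (nu setT < +oo)%E,
        forall j, measurable_fun setT (T ^~ j),
        measurable_fun setT Theta &
        forall (alpha : 'I_n -> nat) beta,
          has_integral nu (fun s => \prod_j T s j ^+ alpha j * Theta s ^+ beta)
            (L (\prod_j t j ^+ alpha j * theta ^+ beta))].
Proof.
have [nu [X [nufin mX X01 X0 IX]]] := positive_representation.
pose bev := bounded_evaluation L u X nu.
pose Theta s := X s None; pose Y s j := X s (Some j) - 2^-1.
have Theta01 s : 0 < Theta s <= 1.
  by rewrite X0; case/andP: (X01 s None).
have bev_u i : bev (X ^~ i) (u i).
  split; first exact: evaluates_coord.
  exists 1; split => // [s|]; first by rewrite ger0_norm; case/andP: (X01 s i).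
  exact: bounded_by_itv.
have bev1 : bev (fun=> 1) 1.
  by apply: eq_bounded_evaluation (bounded_evaluation_cst L u X nu 1); rewrite ?scale1r.
have bevY j : bev (Y ^~ j) (theta * t j).
  have := bounded_evaluationD (bev_u (Some j)) (bounded_evaluation_cst L u X nu (- 2^-1)).
  by apply: eq_bounded_evaluation => //; rewrite theta_tE scaleNr.
have bev_geom k : bev (fun s => geometric_sum (Theta s) k) (geometric_sum theta k).
  apply: bounded_evaluation_sum => i; apply: bounded_evaluationX.
  split.
    apply: evaluatesB; last exact: (evaluates_coord None).
    by case: bev1.
  exists 1; split => // [s|].
    by have /andP[? ?] := X01 s None; rewrite ger0_norm ?subr_ge0// lerBlDr lerDl.
  by apply: bounded_by_itv; rewrite ?subKr//; [exact: (cone_1u None)|exact: (cone_u None)].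
have key M F a : bev F a ->
    has_integral nu (fun s => Theta s ^- M * F s) (L (rho ^+ M * a)).
  elim: M F a => [|M IHM] F a Fa.
    rewrite expr0 mul1r; apply: eq_has_integral (evaluates_integral IX Fa.1) => s.
    by rewrite expr0 invr1 mul1r.
  have Theta_ge0 s : 0 <= Theta s ^- M.
    by rewrite invr_ge0 exprn_ge0// ltW//; case/andP: (Theta01 s).
  have Theta_itv s : 0 <= Theta s <= 1 by exact: X01.
  have geomM k := IHM _ _ (bev_geom k).
  have cvg_geomM s : (fun k => Theta s ^- M * geometric_sum (Theta s) k) @ \oo --> Theta s ^- M.+1.
    by rewrite exprS invfM mulrC; apply: cvgMr; exact: cvg_geometric_sum.
  have [c Ic] : exists c, has_integral nu (fun s => Theta s ^- M.+1) c.
    apply: (has_integral_monotone (B := L (rho ^+ M.+1)) geomM cvg_geomM).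
    - by move=> k s; rewrite mulr_ge0// geometric_sum_ge0.
    - by move=> s k l kl; apply: ler_wpM2l => //; exact: nondecreasing_geometric_sum.
    - move=> k; apply: cone_le => //; rewrite exprSr -mulrBr.
      by apply: coneM; [exact: coneX | exact: cone_rho_geom].
  have [C [C0 FC Ca]] := Fa.2.
  have geomMF k := IHM _ _ (bounded_evaluationM (bev_geom k) Fa).
  have cvgF s : (fun k => Theta s ^- M * (geometric_sum (Theta s) k * F s)) @ \oo
      --> Theta s ^- M.+1 * F s.
    by under eq_fun do rewrite mulrA; apply: cvgMl; exact: cvg_geomM.
  have domF k s : `|Theta s ^- M * (geometric_sum (Theta s) k * F s)| <= C * Theta s ^- M.+1.
    rewrite mulrA normrM mulrC ler_pM//.
    rewrite ger0_norm; last by rewrite mulr_ge0// geometric_sum_ge0.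
    rewrite exprS invfM [leRHS]mulrC; apply: ler_wpM2l => //; exact: geometric_sum_le.
  have [c' Ic' cc'] := has_integral_lim geomMF cvgF (has_integralZ C Ic) domF.
  suff <- : c' = L (rho ^+ M.+1 * a) by [].
  have cT : (fun k => L (rho ^+ M * (geometric_sum theta k * a))) @ \oo --> L (rho ^+ M.+1 * a).
    under eq_fun do rewrite mulrA.
    exact: (cvg_tail (M := M) L_sqr_ge0 thetarho cone_rho cone_rho1 C0 Ca).
  exact: (cvg_unique _ cc' cT).
exists nu, (fun s j => Y s j / Theta s), Theta; split => //.
- move=> j; have := has_integral_measurable (key 1%N _ _ (bevY j)).
  by rewrite (_ : (fun s => _) = (fun s => Y s j / Theta s))//; apply/funext => s; rewrite mulrC.
- exact: mX.
move=> alpha beta; pose M := (\sum_j alpha j)%N.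
have bevab : bev (fun s => \prod_j Y s j ^+ alpha j * Theta s ^+ beta)
    (\prod_j (theta * t j) ^+ alpha j * theta ^+ beta).
  apply: bounded_evaluationM; last exact/bounded_evaluationX/(bev_u None).
  by apply: bounded_evaluation_prod => j; exact: (bounded_evaluationX (alpha j) (bevY j)).
have -> : L (\prod_j t j ^+ alpha j * theta ^+ beta)
    = L (rho ^+ M * (\prod_j (theta * t j) ^+ alpha j * theta ^+ beta)).
  have thetarhoM k h : L ((theta * rho) ^+ k * h) = L h.
    elim: k h => [|k IHk] h; first by rewrite expr0 mul1r.
    by rewrite exprS -mulrA thetarho mul1r IHk.
  rewrite -(thetarhoM M); congr (L _); rewrite exprMn.
  under [in RHS]eq_bigr do rewrite exprMn.
  by rewrite big_split/= prodrXr; ring.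
apply: eq_has_integral (key M _ _ bevab) => s.
under [in RHS]eq_bigr do rewrite exprMn.
by rewrite big_split/= prodrXr exprVn mulrA (mulrC (Theta s ^- M)).
Qed.

End Representation.

(** * Borel sets of R^n and polynomial approximation of the sign *)

Section BorelRn.
Variables (R : realType) (n : nat).

Definition open_box (a b : 'I_n -> R) : set 'rV[R]_n :=
  [set t | forall j, a j < t ord0 j < b j].

Lemma open_open_box a b : open (open_box a b).
Proof.
rewrite openE => t tab; exists (fun _ j => `]a j, b j[%classic) => [i j|s sab j].
  by apply: open_nbhs_nbhs; split; [exact: interval_open | rewrite ord1 /= in_itv/= tab].
by have := sab ord0 j; rewrite /= in_itv.
Qed.

(** A countable base of the topology: it makes open sets Borel and reduces statements on
    null open sets to countably many boxes. *)
Definition rational_box (k : nat) : set 'rV[R]_n :=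
  if choice.unpickle k is Some f then
    open_box (fun j => ratr ((f : {ffun 'I_n -> rat * rat}) j).1) (fun j => ratr (f j).2)
  else set0.

Lemma open_rational_box k : open (rational_box k).
Proof.
by rewrite /rational_box; case: choice.unpickle => [f|]; [exact: open_open_box | exact: open0].
Qed.

Lemma rational_box_nbhs (U : set 'rV[R]_n) t : nbhs t U ->
  exists2 k, rational_box k t & rational_box k `<=` U.
Proof.
move=> [P Pt PU].
have /choice[f fP] : forall j, exists q : rat * rat,
    ratr q.1 < t ord0 j < ratr q.2 /\ `]ratr q.1, ratr q.2[ `<=` P ord0 j.
  move=> j; have /nbhs_ballP[e /= e0 eP] := Pt ord0 j.
  have lt1 : t ord0 j - e < t ord0 j by rewrite ltrBlDr ltrDl.
  have lt2 : t ord0 j < t ord0 j + e by rewrite ltrDl.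
  have [q1] := rat_in_itvoo lt1; have [q2] := rat_in_itvoo lt2.
  rewrite !in_itv/= => /andP[q2a q2b] /andP[q1a q1b].
  exists (q1, q2) => /=; split; first by rewrite q1b q2a.
  move=> x; rewrite /= in_itv/= => /andP[xa xb]; apply: eP.
  by rewrite /ball/= ltr_distlC; apply/andP; split; lra.
exists (choice.pickle [ffun j => f j]); rewrite /rational_box choice.pickleK.
  by move=> j; rewrite !ffunE; have [] := fP j.
move=> s sf; apply: PU => i j; rewrite ord1; apply: (fP j).2.
by have := sf j; rewrite !ffunE /= in_itv.
Qed.

Lemma open_bigcup_rational_box (U : set 'rV[R]_n) : open U ->
  U = \bigcup_(k in [set k | rational_box k `<=` U]) rational_box k.
Proof.
move=> oU; apply/seteqP; split => [t Ut|t [k kU kt]]; last exact: kU.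
have [|k kt kU] := @rational_box_nbhs U t; first exact: open_nbhs_nbhs.
by exists k.
Qed.

Lemma measurable_open_Rn (U : set 'rV[R]_n) : open U -> measurable (U : set (borelRn R n)).
Proof. by move=> oU; exact: sub_sigma_algebra. Qed.

Lemma measurable_coord j : measurable_fun setT (fun t : borelRn R n => (t : 'rV[R]_n) ord0 j).
Proof.
apply: (measurability _ (RGenOpens.measurableE R)).
move=> _ [_ [a [b ->] <-]]; rewrite setTI; apply: measurable_open_Rn.
by apply: open_comp; [move=> t _; exact: coord_continuous | exact: interval_open].
Qed.

Lemma measurable_fun_Rn d (T : measurableType d) (X : T -> 'rV[R]_n) :
  (forall j, measurable_fun setT (fun s => X s ord0 j)) ->
  measurable_fun setT (X : T -> borelRn R n).
Proof.
move=> mX; apply: (measurability _ (erefl _ : @measurable _ (borelRn R n) = <<s open >>)).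
move=> _ [U oU <-]; rewrite setTI (open_bigcup_rational_box oU) preimage_bigcup.
apply: bigcup_measurable => k _; rewrite /rational_box.
case: choice.unpickle => [f|]; last by rewrite preimage_set0.
rewrite (_ : _ @^-1` _ = \bigcap_(j in [set: 'I_n])
    ((fun s => X s ord0 j) @^-1` `]ratr (f j).1, ratr (f j).2[)).
  apply: fin_bigcap_measurable => [|j _]; first exact: finite_finset.
  rewrite -[X in measurable X]setTI.
  by apply: mX => //; exact: measurable_itv.
apply/seteqP; split => s sf j; first by move=> _ /=; rewrite in_itv/=; exact: sf.
by have := sf j I; rewrite /= in_itv.
Qed.

Variable mu : {measure set (borelRn R n) -> \bar R}.

(** A point outside the support has a null rational box around it, and there are
    countably many of these boxes. *)
Lemma msupport_setC_negligible : mu.-negligible (~` msupport mu).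
Proof.
pose null k := if mu (rational_box k) == 0%E then rational_box k else set0.
apply: (@negligibleS _ _ _ mu (\bigcup_k null k)); last first.
  apply: negligible_bigcup => k; rewrite /null; case: eqP => [k0|_].
    exists (rational_box k); split => //.
    exact: (measurable_open_Rn (@open_rational_box k)).
  exact: negligible_set0.
move=> t /existsNP[U] /not_implyP[oU] /not_implyP[Ut] /negP.
rewrite -leNgt => muU.
have [|k kt kU] := @rational_box_nbhs U t; first exact: open_nbhs_nbhs.
exists k => //; rewrite /null ifT//; apply/eqP/le_anti/andP; split; last exact: measure_ge0.
apply: le_trans muU; apply: le_measure; rewrite ?inE//; apply: measurable_open_Rn => //.
exact: open_rational_box.
Qed.

End BorelRn.

Section SignIteration.
Variable R : realType.

Implicit Type x : R.

(** Fixes -1, 0 and 1, maps [-1, 1] to itself and pushes every other point of it away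
    from 0. *)
Definition sign_step x := (3 * x - x ^+ 3) / 2.

(** If y is the sign of x, then (y^2 + y) / 2 is 1 for positive x and 0 otherwise, so the
    limit is the indicator of the positive half-line at 0 too. *)
Definition step_approx k x : R :=
  (iter k sign_step x ^+ 2 + iter k sign_step x) / 2.

Lemma sign_step_itv x : `|x| <= 1 -> `|sign_step x| <= 1.
Proof.
rewrite !ler_norml /sign_step => /andP[x1 x2]; apply/andP.
have : 0 <= (1 - x) ^+ 2 * (2 + x) by rewrite mulr_ge0 ?sqr_ge0//; lra.
have : 0 <= (1 + x) ^+ 2 * (2 - x) by rewrite mulr_ge0 ?sqr_ge0//; lra.
by split; lra.
Qed.

Lemma iter_sign_step_itv k x : `|x| <= 1 -> `|iter k sign_step x| <= 1.
Proof. by move=> x1; elim: k => //= k; exact: sign_step_itv. Qed.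

Lemma step_approx_itv k x : `|x| <= 1 -> `|step_approx k x| <= 1.
Proof.
move=> /(iter_sign_step_itv k); rewrite /step_approx; set y := iter _ _ _.
rewrite normrM (@ger0_norm _ 2^-1) ?invr_ge0// ler_pdivrMr// mul1r => y1.
apply: le_trans (ler_normD _ _) _; rewrite normrX -[2]/(1 + 1) lerD//.
by rewrite exprn_ile1.
Qed.

(** 1 - sign_step y = (1 - y) (2 - y - y^2) / 2, and the iterates increase, so the distance
    to 1 shrinks at each step by a factor of at most 1 - x / 2. *)
Lemma cvg_iter_sign_step x : 0 < x <= 1 -> iter k sign_step x @[k --> \oo] --> (1 : R).
Proof.
move=> /andP[x0 x1].
have bnd k : x <= iter k sign_step x <= 1 /\ 1 - iter k sign_step x <= (1 - x / 2) ^+ k.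
  elim: k => [|k [/andP[IH1 IH2] IH3]] /=; first by rewrite lexx x1 expr0; split => //; lra.
  set y := iter k sign_step x in IH1 IH2 IH3 *.
  have y0 : 0 <= y by lra.
  have E : 1 - sign_step y = (1 - y) * ((2 - y - y ^+ 2) / 2) by rewrite /sign_step; field.
  have E' : sign_step y - y = y * (1 - y) * (1 + y) / 2 by rewrite /sign_step; field.
  have D : 0 <= y * (1 - y) * (1 + y) / 2.
    by rewrite divr_ge0// !mulr_ge0//; lra.
  have F0 : 0 <= (2 - y - y ^+ 2) / 2.
    by rewrite divr_ge0// (_ : _ - _ = (1 - y) * (2 + y)) ?mulr_ge0; [|lra|lra|ring].
  split; first by apply/andP; split; [lra | rewrite -subr_ge0 E mulr_ge0//; lra].
  rewrite E [leRHS]exprSr; apply: ler_pM => //; first by lra.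
  have : 0 <= y ^+ 2 by exact: sqr_ge0.
  lra.
apply/cvgrPdist_le => e e0.
have c0 : (fun k => (1 - x / 2) ^+ k) @ \oo --> (0 : R).
  by apply: cvg_expr; rewrite ger0_norm; lra.
move/cvgrPdist_le/(_ e e0): c0; apply: filterS => k.
have [/andP[b1 b2] b3] := bnd k.
rewrite sub0r normrN => /(le_trans (ler_norm _)); apply: le_trans.
by rewrite ger0_norm ?subr_ge0.
Qed.

Lemma cvg_step_approx x : `|x| <= 1 -> step_approx k x @[k --> \oo] --> ((0 < x)%R%:R : R).
Proof.
have quad (s l : R) (y : nat -> R) : y @ \oo --> l ->
    (fun k => (y k ^+ 2 + y k) / 2) @ \oo --> (l ^+ 2 + l) / 2.
  by move=> yl; apply: cvgMl; apply: cvgD => //; under eq_fun do rewrite expr2; exact: cvgM.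
rewrite ler_norml => /andP[x1 x2]; have [x0|x0|<-] := ltgtP 0 x.
- have -> : true%:R = (1 ^+ 2 + 1) / 2 :> R by rewrite -[true%:R]/(1 : R); field.
  by apply: (quad 0) => //; apply: cvg_iter_sign_step; rewrite x0.
- have -> : false%:R = ((- 1) ^+ 2 + - 1) / 2 :> R by rewrite -[false%:R]/(0 : R); field.
  apply: (quad 0) => //.
  have odd k : iter k sign_step x = - iter k sign_step (- x).
    elim: k => [|k IHk] /=; first by rewrite opprK.
    by rewrite IHk /sign_step; field.
  under eq_fun do rewrite odd.
  by apply: cvgN; apply: cvg_iter_sign_step; apply/andP; split; lra.
have -> : false%:R = (0 ^+ 2 + 0) / 2 :> R by rewrite -[false%:R]/(0 : R); field.
apply: (quad 0) => //; rewrite (_ : (fun k => _) = cst 0); first exact: cvg_cst.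
apply/funext => k /=; elim: k => //= k ->.
by rewrite /sign_step expr0n mulr0 subr0 mul0r.
Qed.

End SignIteration.

(** * Linear forms on polynomials and the extra variable *)

Section CoefficientFunctional.
Variables (K : comNzRingType) (N : nat) (c : multinom N -> K).
Implicit Types (f g : mpoly N K) (m : multinom N).

(** Over [R[i]] this is [riesz]; the same formula over [R] gives the real form attached
    to a real sequence. *)
Definition coef_functional f : K := \sum_(m <- msupp f) mcoeff m f * c m.

Lemma coef_functional_sub f s : uniq s -> {subset msupp f <= s} ->
  coef_functional f = \sum_(m <- s) mcoeff m f * c m.
Proof.
move=> us fs; rewrite (bigID (fun m => m \in msupp f))/= [X in _ + X]big1 ?addr0.
  rewrite -big_filter; apply: perm_big; apply: uniq_perm.
  - exact: msupp_uniq.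
  - exact: filter_uniq.
  - by move=> m; rewrite mem_filter; case: (boolP (m \in msupp f)) => //= /fs.
by move=> m mf; rewrite memN_msupp_eq0 ?mul0r.
Qed.

Lemma coef_functional_is_scalar : scalar coef_functional.
Proof.
move=> a f g; pose s := undup (msupp f ++ msupp g ++ msupp (a *: f + g)).
have us : uniq s by exact: undup_uniq.
rewrite (@coef_functional_sub f s) //; last first.
  by move=> m; rewrite mem_undup !mem_cat => ->.
rewrite (@coef_functional_sub g s) //; last first.
  by move=> m; rewrite mem_undup !mem_cat => ->; rewrite orbT.
rewrite (@coef_functional_sub (a *: f + g) s) //; last first.
  by move=> m; rewrite mem_undup !mem_cat => ->; rewrite !orbT.
rewrite mulr_sumr -big_split; apply: eq_bigr => m _ /=.
by rewrite mcoeffD mcoeffZ mulrDl mulrA.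
Qed.

HB.instance Definition _ := GRing.isLinear.Build K (mpoly N K) K *%R coef_functional
  coef_functional_is_scalar.

Lemma coef_functionalX m : coef_functional (mpolyX K m) = c m.
Proof. by rewrite /coef_functional msuppX big_seq1 mcoeffX eqxx mul1r. Qed.

End CoefficientFunctional.

Lemma scalar_mpolyE (K : comNzRingType) N (L : {scalar (mpoly N K)}) f :
  L f = \sum_(m <- msupp f) mcoeff m f * L (mpolyX K m).
Proof.
rewrite {1}[f]mpolyE raddf_sum; apply: eq_bigr => m _ /=.
by rewrite scalarZ.
Qed.

Section JoinIndex.
Variable n : nat.
Implicit Types (alpha : multinom n) (beta : nat) (mu : multinom n.+1).

Definition mnm_join alpha beta : multinom n.+1 :=
  Multinom [tuple if unlift ord_max i is Some j then alpha j else beta | i < n.+1].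

Lemma widen_lift (j : 'I_n) : widen_ord (leqnSn n) j = lift ord_max j.
Proof. by apply: val_inj => /=; rewrite /bump leqNgt ltn_ord. Qed.

Lemma mnm_join_widen alpha beta (j : 'I_n) :
  mnm_join alpha beta (widen_ord (leqnSn n) j) = alpha j.
Proof. by rewrite widen_lift multinomE tnth_mktuple liftK. Qed.

Lemma mnm_join_max alpha beta : mnm_join alpha beta ord_max = beta.
Proof. by rewrite multinomE tnth_mktuple unlift_none. Qed.

Lemma mnm_joinK alpha beta : mnm_split (mnm_join alpha beta) = (alpha, beta).
Proof.
rewrite /mnm_split mnm_join_max; congr pair; apply/mnmP => j.
by rewrite multinomE tnth_mktuple mnm_join_widen.
Qed.

Lemma mnm_splitK mu : mnm_join (mnm_split mu).1 (mnm_split mu).2 = mu.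
Proof.
apply/mnmP => i; rewrite multinomE tnth_mktuple; case: unliftP => [j ->|->] //=.
by rewrite multinomE tnth_mktuple widen_lift.
Qed.

Lemma mnm_joinD alpha alpha' beta beta' :
  mnm_join alpha beta +m mnm_join alpha' beta' = mnm_join (alpha +m alpha') (beta + beta').
Proof.
apply/mnmP => i; rewrite mnmDE !multinomE !tnth_mktuple.
by case: unlift => [j|//]; rewrite mnmDE.
Qed.

End JoinIndex.

(** * Complex extensions are real linear forms *)

Section ComplexPolynomials.
Local Open Scope complex_scope.
Variables (R : realType) (N : nat).
Implicit Types (g h : mpoly N R) (f : mpoly N R[i]) (c : multinom N -> R[i])
  (d : multinom N -> R).

Local Notation toC := (map_mpoly (real_complex R)).

Lemma complex_mpoly_split f : exists g h, f = toC g + 'i%C *: toC h.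
Proof.
exists (\sum_(m <- msupp f) complex.Re (mcoeff m f) *: mpolyX R m),
  (\sum_(m <- msupp f) complex.Im (mcoeff m f) *: mpolyX R m).
have toC_sum (b : multinom N -> R) :
    toC (\sum_(m <- msupp f) b m *: mpolyX R m) = \sum_(m <- msupp f) (b m)%:C *: mpolyX _ m.
  by rewrite raddf_sum; apply: eq_bigr => m _ /=; rewrite map_mpolyZ map_mpolyX.
rewrite !toC_sum scaler_sumr -big_split {1}[f]mpolyE; apply: eq_bigr => m _ /=.
rewrite scalerA -scalerDl; congr (_ *: _).
by case: (mcoeff m f) => x y; simpc.
Qed.

Lemma conj_mpoly_real g : map_mpoly conjc (toC g) = toC g.
Proof.
apply/mpolyP => m; rewrite [LHS]mcoeff_map_mpoly.
have -> : mcoeff m (toC g) = (mcoeff m g)%:C by exact: mcoeff_map_mpoly.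
exact: conjc_real.
Qed.

Lemma mul_conj_scaled (K : comNzRingType) (A : comAlgType K) (k : K) (x y : A) :
  (x + k *: y) * (x - k *: y) = x ^+ 2 - k ^+ 2 *: y ^+ 2.
Proof. by rewrite mulrC -subr_sqr exprZn. Qed.

Lemma conj_mcoeff_split (f f' : mpoly N R[i]) m (x x' : R) :
  mcoeff m f = x%:C -> mcoeff m f' = x'%:C ->
  mcoeff m (map_mpoly conjc (f + 'i%C *: f')) = mcoeff m (f - 'i%C *: f').
Proof.
by move=> fx fx'; rewrite [LHS]mcoeff_map_mpoly !mcoeffD mcoeffN !mcoeffZ fx fx'; simpc.
Qed.

Lemma conj_mpoly_split g h :
  map_mpoly conjc (toC g + 'i%C *: toC h) = toC g - 'i%C *: toC h.
Proof. by apply/mpolyP => m; apply: conj_mcoeff_split; exact: mcoeff_map_mpoly. Qed.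

(** |g + i h|^2 = g^2 + h^2, so complex and real positivity agree for real sequences. *)
Lemma mul_conj_mpoly g h :
  (toC g + 'i%C *: toC h) * map_mpoly conjc (toC g + 'i%C *: toC h)
  = toC (g ^+ 2 + h ^+ 2).
Proof.
rewrite conj_mpoly_split mul_conj_scaled.
have -> : ('i%C : R[i]) ^+ 2 = -1 by rewrite expr2; simpc.
rewrite scaleN1r opprK.
have -> : toC (g ^+ 2 + h ^+ 2) = toC (g ^+ 2) + toC (h ^+ 2) by exact: raddfD.
have toCX q : toC (q ^+ 2) = toC q ^+ 2 by exact: rmorphXn.
by rewrite !toCX.
Qed.

Lemma coef_functional_real d g :
  coef_functional (fun m => (d m)%:C) (toC g) = (coef_functional d g)%:C.
Proof.
rewrite (@coef_functional_sub _ _ _ _ (msupp g)) ?msupp_uniq//; last first.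
  move=> m; rewrite !mcoeff_msupp mcoeff_map_mpoly; apply: contra => /eqP ->.
  by apply/eqP; exact: rmorph0.
rewrite /coef_functional rmorph_sum; apply: eq_bigr => m _.
by rewrite mcoeff_map_mpoly rmorphM.
Qed.

Lemma psd_real d : psd (fun m => (d m)%:C) <->
  forall g, 0 <= coef_functional d (g ^+ 2).
Proof.
split=> [pd g|pd f].
  have := pd (toC g); rewrite conj_mpoly_real -rmorphM -expr2.
  by rewrite -[riesz _ _]/(coef_functional _ _) coef_functional_real lecR.
have [g [h ->]] := complex_mpoly_split f; rewrite mul_conj_mpoly.
rewrite -[riesz _ _]/(coef_functional _ _) coef_functional_real lecR raddfD.
by apply: addr_ge0; exact: pd.
Qed.

(** Test positivity on X^m + 1: the values at X^(2m) and 1 are real, hence so is twice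
    the value at X^m. *)
Lemma psd_is_real c : psd c -> forall m, c m = (complex.Re (c m))%:C.
Proof.
move=> pc.
have real_of_sum (x y : R[i]) : complex.Im x = 0 -> 0 <= x + y *+ 2 -> complex.Im y = 0.
  rewrite lecE => x0 /andP[/eqP]; case: x x0 => x x' /= ->; case: y => y y' /=.
  by rewrite add0r => /eqP; rewrite -mulr2n mulrn_eq0/= => /eqP.
have rieszX m m' : riesz c (mpolyX _ m * mpolyX _ m') = c (m +m m').
  by rewrite -mpolyXD -[riesz _ _]/(coef_functional _ _) coef_functionalX.
have conjX m : map_mpoly conjc (mpolyX R[i] m) = mpolyX _ m by rewrite map_mpolyX.
have sq m : 0 <= c (m +m m) by rewrite -rieszX -{2}conjX.
have Im0 m : complex.Im (c m) = 0.
  have := pc (mpolyX _ m + mpolyX _ (@mnm0 N)); rewrite rmorphD/= !conjX.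
  rewrite mulrDl !mulrDr -[riesz _ _]/(coef_functional _ _) !raddfD /=.
  rewrite -!mpolyXD !coef_functionalX addm0 add0m => H.
  apply: (real_of_sum (c (m +m m) + c (@mnm0 N +m @mnm0 N))).
    have := sq m; have := sq (@mnm0 N); rewrite !lecE => /andP[/eqP A _] /andP[/eqP B _].
    by case: (c _) A => ? ? /= ->; case: (c _) B => ? ? /= ->; rewrite addr0.
  move: H; rewrite add0m; congr (_ <= _); rewrite mulr2n.
  by rewrite [in LHS](addrC (c m) (c mnm0)) addrACA.
by move=> m; move: (Im0 m); case: (c m) => x y /= ->.
Qed.

(** Multiplying the argument by a polynomial amounts to replacing the sequence by the
    corresponding combination of its shifts; this turns the positivity of the shifted
    sequences into that of [p_k * L]. *)
Lemma coef_functional_shift (d : multinom N -> R) (T : Type) (s : seq T)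
    (b : T -> R) (J : T -> multinom N) g :
  coef_functional d ((\sum_(xi <- s) b xi *: mpolyX R (J xi)) * g)
  = coef_functional (fun m => \sum_(xi <- s) b xi * d (m +m J xi)) g.
Proof.
rewrite {1}[g]mpolyE mulr_sumr raddf_sum; apply: eq_bigr => m _ /=.
rewrite -scalerAr scalarZ mulr_suml raddf_sum; congr (_ * _); apply: eq_bigr => xi _ /=.
by rewrite -scalerAl scalarZ /= -mpolyXD coef_functionalX addmC.
Qed.

End ComplexPolynomials.

Section RealExtension.
Local Open Scope complex_scope.
Variables (R : realType) (n m : nat).
Variables (I : 'I_m -> {fset multinom n}) (a : 'I_m -> multinom n -> R).
Implicit Types (d : multinom n.+1 -> R) (gamma : multinom n -> R).

Definition coord_var (j : 'I_n) : mpoly n.+1 R := mpolyX R (mnm_join (mnm1 j) 0).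

Definition theta_var : mpoly n.+1 R := mpolyX R (mnm_join (@mnm0 n) 1).

Definition lifted (k : 'I_m) : mpoly n.+1 R :=
  \sum_(xi <- I k) a k xi *: mpolyX R (mnm_join xi 0).

Definition weight : mpoly n.+1 R :=
  1 + \sum_j coord_var j ^+ 2 + \sum_k lifted k ^+ 2.

(** The conditions on an extension in terms of its linear form: the recursion in the
    last index says that the form does not distinguish [theta_var * weight] from 1. *)
Definition real_extension gamma d : Prop :=
  [/\ forall g, 0 <= coef_functional d (g ^+ 2),
      forall alpha, gamma alpha = d (mnm_join alpha 0),
      forall h, coef_functional d (theta_var * weight * h) = coef_functional d h
    & forall k g, 0 <= coef_functional d (lifted k * g ^+ 2)].

Lemma lifted_sqr k : lifted k ^+ 2 =
  \sum_(xi <- I k) \sum_(eta <- I k) (a k xi * a k eta) *: mpolyX R (mnm_join (xi +m eta) 0).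
Proof.
rewrite expr2 {1}/lifted mulr_suml; apply: eq_bigr => xi _.
rewrite /lifted mulr_sumr; apply: eq_bigr => eta _.
by rewrite -scalerAl -scalerAr scalerA -mpolyXD mnm_joinD.
Qed.

Lemma theta_weight_monomial d alpha beta :
  coef_functional d (theta_var * weight * mpolyX R (mnm_join alpha beta)) =
    d (mnm_join alpha beta.+1)
    + \sum_(j < n) d (mnm_join (alpha +m mnm_muln (mnm1 j) 2) beta.+1)
    + \sum_(k < m) \sum_(xi <- I k) \sum_(eta <- I k)
        a k xi * a k eta * d (mnm_join (alpha +m xi +m eta) beta.+1).
Proof.
have thetaX : theta_var * mpolyX R (mnm_join alpha beta) = mpolyX R (mnm_join alpha beta.+1).
  by rewrite -mpolyXD mnm_joinD add0m.
rewrite mulrAC thetaX /weight !mulrDr mulr1 !raddfD /= coef_functionalX.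
congr (_ + _ + _).
  rewrite mulr_sumr raddf_sum; apply: eq_bigr => j _ /=.
  by rewrite expr2 -!mpolyXD coef_functionalX !mnm_joinD !addn0.
rewrite mulr_sumr raddf_sum; apply: eq_bigr => k _ /=.
rewrite lifted_sqr mulr_sumr raddf_sum; apply: eq_bigr => xi _ /=.
rewrite mulr_sumr raddf_sum; apply: eq_bigr => eta _ /=.
by rewrite -scalerAr scalarZ /= -mpolyXD coef_functionalX mnm_joinD addn0 addmA.
Qed.

Lemma extension_realE gamma d :
  extension I a gamma (fun ab => (d (mnm_join ab.1 ab.2))%:C) <-> real_extension gamma d.
Proof.
have splitE : (fun ab => (d (mnm_join ab.1 ab.2))%:C) \o @mnm_split n = fun mu => (d mu)%:C.
  by apply/funext => mu /=; rewrite mnm_splitK.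
have shiftE k : (fun ab => \sum_(xi <- I k) (a k xi)%:C * (d (mnm_join (ab.1 +m xi) ab.2))%:C)
    \o @mnm_split n = fun mu => (\sum_(xi <- I k) a k xi * d (mu +m mnm_join xi 0))%:C.
  apply/funext => mu; rewrite rmorph_sum; apply: eq_bigr => xi _.
  have -> : mu +m mnm_join xi 0 = mnm_join ((mnm_split mu).1 +m xi) (mnm_split mu).2.
    by rewrite -{1}(mnm_splitK mu) mnm_joinD addn0.
  by rewrite rmorphM.
have recE alpha beta :
    ((d (mnm_join alpha beta))%:C = (d (mnm_join alpha beta.+1))%:C
      + \sum_(j < n) (d (mnm_join (alpha +m mnm_muln (mnm1 j) 2) beta.+1))%:C
      + \sum_(k < m) \sum_(xi <- I k) \sum_(eta <- I k) (a k xi)%:C * (a k eta)%:C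
          * (d (mnm_join (alpha +m xi +m eta) beta.+1))%:C) <->
    coef_functional d (theta_var * weight * mpolyX R (mnm_join alpha beta)) =
    coef_functional d (mpolyX R (mnm_join alpha beta)).
  rewrite theta_weight_monomial coef_functionalX.
  set s2 := \sum_(j < n) d _; set s3 := \sum_(k < m) \sum_(xi <- I k) \sum_(eta <- I k) _ * d _.
  have -> : \sum_(j < n) (d (mnm_join (alpha +m mnm_muln (mnm1 j) 2) beta.+1))%:C = s2%:C.
    by rewrite rmorph_sum.
  have -> : \sum_(k < m) \sum_(xi <- I k) \sum_(eta <- I k) (a k xi)%:C * (a k eta)%:C
          * (d (mnm_join (alpha +m xi +m eta) beta.+1))%:C = s3%:C.
    rewrite rmorph_sum; apply: eq_bigr => k _; rewrite rmorph_sum; apply: eq_bigr => xi _.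
    by rewrite rmorph_sum; apply: eq_bigr => eta _; rewrite !rmorphM.
  have -> : (d (mnm_join alpha beta.+1))%:C + s2%:C + s3%:C =
      (d (mnm_join alpha beta.+1) + s2 + s3)%:C by rewrite !rmorphD.
  by split=> [/complexI -> //|<-].
rewrite /extension /real_extension; split=> -[pd gd rec pk]; split.
- by apply/psd_real; rewrite -splitE.
- by move=> alpha; apply: complexI; rewrite gd.
- move=> h; rewrite {1}[h]mpolyE [in RHS]scalar_mpolyE mulr_sumr raddf_sum.
  apply: eq_bigr => mu _ /=; rewrite -scalerAr scalarZ; congr (_ * _).
  by rewrite -(mnm_splitK mu); apply/recE; exact: rec.
- move=> k g; rewrite coef_functional_shift; apply/psd_real: g.
  by rewrite -shiftE; exact: pk.
- by rewrite /psd_pair splitE; apply/psd_real.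
- by move=> alpha; rewrite gd.
- by move=> alpha beta; apply/recE; exact: rec.
- move=> k; rewrite /psd_pair shiftE; apply/psd_real => g.
  by have := pk k g; rewrite coef_functional_shift.
Qed.

Lemma extension_is_real gamma delta : extension I a gamma delta ->
  exists d, real_extension gamma d /\
    delta = (fun ab => (d (mnm_join ab.1 ab.2))%:C).
Proof.
move=> ext; have [pd _ _ _] := ext.
pose d mu := complex.Re (delta (mnm_split mu)).
have dE : delta = (fun ab => (d (mnm_join ab.1 ab.2))%:C).
  apply/funext => -[alpha beta]; rewrite /d mnm_joinK.
  by have /= := psd_is_real pd (mnm_join alpha beta); rewrite mnm_joinK.
by exists d; split=> //; apply/extension_realE; rewrite -dE.
Qed.

End RealExtension.

(** * Evaluation at (t, theta(t)) *)

Section Evaluations.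
Variables (R : realType) (n m : nat).
Variables (I : 'I_m -> {fset multinom n}) (a : 'I_m -> multinom n -> R).

Definition extend_point (y : R) (x : 'I_n -> R) (i : 'I_n.+1) : R :=
  if unlift ord_max i is Some j then x j else y.

Lemma meval_join y x alpha beta :
  meval (extend_point y x) (mpolyX R (mnm_join alpha beta))
  = \prod_j x j ^+ alpha j * y ^+ beta.
Proof.
rewrite mevalX big_ord_recr /= mnm_join_max /extend_point unlift_none; congr (_ * _).
by apply: eq_bigr => j _; rewrite mnm_join_widen widen_lift liftK.
Qed.

Lemma meval_coord y x j : meval (extend_point y x) (coord_var R j) = x j.
Proof.
rewrite meval_join expr0 mulr1 (bigD1 j)//= mnm1E eqxx expr1 big1 ?mulr1// => i ij.
by rewrite mnm1E eq_sym (negbTE ij) expr0.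
Qed.

Lemma meval_theta y x : meval (extend_point y x) (theta_var R n) = y.
Proof. by rewrite meval_join big1 ?mul1r// => j _; rewrite mnm0E expr0. Qed.

Definition lifted_value (k : 'I_m) (x : 'I_n -> R) : R :=
  \sum_(xi <- I k) a k xi * \prod_j x j ^+ xi j.

Lemma meval_lifted y x k : meval (extend_point y x) (lifted I a k) = lifted_value k x.
Proof.
rewrite /lifted raddf_sum; apply: eq_bigr => xi _ /=.
by rewrite mevalZ meval_join expr0 mulr1.
Qed.

Definition weight_value (x : 'I_n -> R) : R :=
  1 + \sum_j x j ^+ 2 + \sum_k lifted_value k x ^+ 2.

Lemma meval_weight y x : meval (extend_point y x) (weight I a) = weight_value x.
Proof.
rewrite /weight !mevalD meval1 !raddf_sum /weight_value; congr (_ + _ + _).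
  by apply: eq_bigr => j _ /=; rewrite rmorphXn /= meval_coord.
by apply: eq_bigr => k _ /=; rewrite rmorphXn /= meval_lifted.
Qed.

Lemma weight_value_ge1 x : 1 <= weight_value x.
Proof.
rewrite /weight_value -addrA lerDl addr_ge0// sumr_ge0// => i _; exact: sqr_ge0.
Qed.

Lemma weight_value_gt0 x : 0 < weight_value x.
Proof. exact: lt_le_trans (weight_value_ge1 x). Qed.

Lemma coord_le_weight x j : `|x j| <= weight_value x.
Proof.
apply: (@le_trans _ _ (1 + x j ^+ 2)).
  by have := sqr_ge0 (`|x j| - 1); rewrite -(real_normK (num_real (x j))); nra.
rewrite /weight_value -addrA lerD2l (bigD1 j)//= -addrA lerDl.
by rewrite addr_ge0// sumr_ge0// => i _; exact: sqr_ge0.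
Qed.

Lemma lifted_le_weight x k : `|lifted_value k x| <= weight_value x.
Proof.
apply: (@le_trans _ _ (1 + lifted_value k x ^+ 2)).
  have := sqr_ge0 (`|lifted_value k x| - 1).
  by rewrite -(real_normK (num_real (lifted_value k x))); nra.
rewrite /weight_value -addrA lerD2l (bigD1 k)//= addrCA lerDl.
by rewrite addr_ge0// sumr_ge0// => i _; exact: sqr_ge0.
Qed.

(** The rational functions of [t] whose integrals are prescribed by an extension. *)
Definition rational_eval (f : mpoly n.+1 R) (t : 'rV[R]_n) : R :=
  meval (extend_point (weight_value (t ord0))^-1 (t ord0)) f.

Lemma rational_eval_monomial alpha beta t :
  rational_eval (mpolyX R (mnm_join alpha beta)) t
  = monomial alpha t * (weight_value (t ord0))^-1 ^+ beta.
Proof. exact: meval_join. Qed.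

Lemma rational_eval_relation h t :
  rational_eval (theta_var R n * weight I a * h) t = rational_eval h t.
Proof.
rewrite /rational_eval !mevalM meval_theta meval_weight mulVf ?mul1r//.
by rewrite gt_eqF// weight_value_gt0.
Qed.

Lemma rational_evalE f t :
  rational_eval f t = \sum_(mu <- msupp f) mcoeff mu f * rational_eval (mpolyX R mu) t.
Proof.
rewrite {1}/rational_eval {1}[f]mpolyE raddf_sum; apply: eq_bigr => mu _ /=.
by rewrite mevalZ.
Qed.

Lemma measurable_monomial alpha :
  measurable_fun setT (fun t : borelRn R n => monomial alpha (t : 'rV[R]_n)).
Proof.
by apply: measurable_prod => j _; exact: (measurable_funX (alpha j) (@measurable_coord R n j)).
Qed.

Lemma measurable_lifted_value k :
  measurable_fun setT (fun t : borelRn R n => lifted_value k ((t : 'rV[R]_n) ord0)).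
Proof.
apply: measurable_sum => xi; apply: measurable_funM; first exact: measurable_cst.
exact: measurable_monomial.
Qed.

(** The inverse is written as a real power to use the measurability of the latter. *)
Lemma measurable_weight_inv :
  measurable_fun setT (fun t : borelRn R n => (weight_value ((t : 'rV[R]_n) ord0))^-1).
Proof.
have -> : (fun t : borelRn R n => (weight_value ((t : 'rV[R]_n) ord0))^-1)
    = (fun y => powR y (-1)) \o (fun t : borelRn R n => weight_value ((t : 'rV[R]_n) ord0)).
  by apply/funext => t /=; rewrite powR_inv1// ltW// weight_value_gt0.
apply: measurableT_comp; first exact: measurable_powR.
apply: measurable_funD; first apply: measurable_funD; first exact: measurable_cst.
  by apply: measurable_sum => j; exact: (measurable_funX 2 (@measurable_coord R n j)).
by apply: measurable_sum => k; exact: (measurable_funX 2 (measurable_lifted_value k)).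
Qed.

Lemma measurable_rational_eval f :
  measurable_fun setT (fun t : borelRn R n => rational_eval f (t : 'rV[R]_n)).
Proof.
under eq_fun do rewrite rational_evalE.
apply: measurable_sum => mu; apply: measurable_funM; first exact: measurable_cst.
rewrite -(mnm_splitK mu) (_ : rational_eval _ = fun t => monomial (mnm_split mu).1 t *
    (weight_value (t ord0))^-1 ^+ (mnm_split mu).2); last first.
  by apply/funext => t; exact: rational_eval_monomial.
apply: measurable_funM; first exact: measurable_monomial.
exact: (measurable_funX (mnm_split mu).2 measurable_weight_inv).
Qed.

Lemma step_approx_poly (s : mpoly n.+1 R) k :
  exists g, forall t, rational_eval g t = step_approx k (rational_eval s t).
Proof.
have [g gs] : exists g, forall t, rational_eval g t = iter k (@sign_step R) (rational_eval s t).
  elim: k => [|k [g gs]]; first by exists s.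
  exists (2^-1 *: (3 *: g - g ^+ 3)) => t.
  rewrite /rational_eval mevalZ mevalB mevalZ rmorphXn /= -/(rational_eval g t) gs.
  by rewrite /sign_step mulrC.
exists (2^-1 *: (g ^+ 2 + g)) => t.
rewrite /rational_eval mevalZ mevalD rmorphXn /= -/(rational_eval g t) gs.
by rewrite /step_approx mulrC.
Qed.

End Evaluations.

(** * Determinacy *)

Section MomentMeasures.
Variables (R : realType) (n m : nat).
Variables (I : 'I_m -> {fset multinom n}) (a : 'I_m -> multinom n -> R).
Local Notation eval_at := (rational_eval I a).
Local Notation wt t := (weight_value I a ((t : 'rV[R]_n) ord0)).
Implicit Types (mu nu : {measure set (borelRn R n) -> \bar R})
  (d : multinom n.+1 -> R).

Definition moments_of mu d :=
  forall alpha, has_integral mu (eval_at (mpolyX R alpha)) (d alpha).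

Lemma moments_of_poly mu d f : moments_of mu d ->
  has_integral mu (eval_at f) (coef_functional d f).
Proof.
move=> mud.
apply: eq_has_integral (has_integral_sum (msupp f)
  (fun al => has_integralZ (mcoeff al f) (mud al))) => t.
by rewrite [RHS]rational_evalE.
Qed.

Lemma eval_at_one t : eval_at 1 t = 1.
Proof. exact: meval1. Qed.

Lemma has_integral1_fin mu c : has_integral mu (fun=> 1 : R) c -> (mu setT < +oo)%E.
Proof. by move=> [_]; rewrite integral_cst//= mul1e => ->; exact: ltry. Qed.

Lemma moments_of_fin mu d : moments_of mu d -> (mu setT < +oo)%E.
Proof.
move=> /moments_of_poly => /(_ 1) mu1; 
suff H : has_integral mu (fun=> 1 : R) (coef_functional d 1) by exact: has_integral1_fin H.
by apply: eq_has_integral mu1 => t; exact: eval_at_one.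
Qed.

Lemma inv_weight_itv t : 0 < (wt t)^-1 <= 1.
Proof. by rewrite invr_gt0 weight_value_gt0/= invf_le1 ?weight_value_gt0 ?weight_value_ge1. Qed.

(** [theta (t_j - c)] is bounded by [1 + |c|] because both 1 and |t_j| are at most the weight;
    multiplying by the positive function [theta] does not change signs. *)
Lemma halfspace_poly (e : R) (j : 'I_n) (c : R) : `|e| = 1 ->
  exists s : mpoly n.+1 R,
    (forall t, `|eval_at s t| <= 1) /\
    (forall t, (0 < eval_at s t) = (0 < e * (t ord0 j - c))).
Proof.
move=> e1; exists ((e / (1 + `|c|)) *: (theta_var R n * (coord_var R j - c *: 1))).
have sE t : eval_at ((e / (1 + `|c|)) *: (theta_var R n * (coord_var R j - c *: 1))) t
    = (wt t)^-1 / (1 + `|c|) * (e * (t ord0 j - c)).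
  rewrite /rational_eval mevalZ mevalM meval_theta mevalB mevalZ meval1 meval_coord mulr1.
  by ring.
have c_gt0 : 0 < 1 + `|c| by rewrite ltr_pwDl.
split=> t; rewrite sE; last first.
  by rewrite pmulr_rgt0// divr_gt0//; case/andP: (inv_weight_itv t).
rewrite normrM gtr0_norm; last by rewrite divr_gt0//; case/andP: (inv_weight_itv t).
rewrite normrM e1 mul1r -invfM mulrC ler_pdivrMr; last by rewrite mulr_gt0// weight_value_gt0.
rewrite mul1r (le_trans (ler_normB _ _))// mulrDr mulr1 lerD ?coord_le_weight//.
by rewrite ler_peMl// weight_value_ge1.
Qed.

Lemma box_indicator_limit (lo hi : 'I_n -> R) :
  exists g : nat -> mpoly n.+1 R,
    (forall k t, `|eval_at (g k) t| <= 1) /\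
    (forall t, (fun k => eval_at (g k) t) @ \oo --> (\1_(open_box lo hi) t : R)).
Proof.
have /choice[s sP] := fun j => @halfspace_poly 1 j (lo j) (normr1 _).
have /choice[s' sP'] := fun j => @halfspace_poly (-1) j (hi j) (normrN1 _).
have /choice[g gP] : forall k, exists g : mpoly n.+1 R, forall t, eval_at g t =
    \prod_j (step_approx k (eval_at (s j) t) * step_approx k (eval_at (s' j) t)).
  move=> k; have /choice[h hP] := fun j => @step_approx_poly _ _ _ I a (s j) k.
  have /choice[h' hP'] := fun j => @step_approx_poly _ _ _ I a (s' j) k.
  exists (\prod_j (h j * h' j)) => t.
  rewrite /rational_eval rmorph_prod; apply: eq_bigr => j _ /=.
  by rewrite mevalM -!/(rational_eval _ _ _ _) hP hP'.
exists g; split => [k t|t].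
  have normM1 (x y : R) : `|x| <= 1 -> `|y| <= 1 -> `|x * y| <= 1.
    by move=> x1 y1; rewrite normrM mulr_ile1.
  rewrite gP; apply: (big_ind (fun x => `|x| <= 1)) => // [|j _]; first by rewrite normr1.
  apply: normM1; apply: step_approx_itv.
    by have [] := sP j.
  by have [] := sP' j.
under eq_fun do rewrite gP.
have -> : \1_(open_box lo hi) t = \prod_j ((lo j < t ord0 j)%R%:R * (t ord0 j < hi j)%R%:R) :> R.
  rewrite indicE; have [/set_mem tb|/negP tb] := boolP (t \in open_box lo hi).
    by rewrite big1// => j _; have /andP[-> ->] := tb j; rewrite mulr1.
  have /existsNP[j /negP] : ~ (forall j, lo j < t ord0 j < hi j).
    by move=> H; apply: tb; rewrite inE.
  by rewrite (bigD1 j)//= negb_and => /orP[|] /negbTE ->; rewrite ?mulr0 ?mul0r.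
apply: cvg_big => [|j _]; first exact: mul_continuous.
have [sj1 sj2] := sP j; have [sj1' sj2'] := sP' j.
have -> : (lo j < t ord0 j) = (0 < eval_at (s j) t) by rewrite sj2 mul1r subr_gt0.
have -> : (t ord0 j < hi j) = (0 < eval_at (s' j) t) by rewrite sj2' mulN1r opprB subr_gt0.
by apply: cvgM; apply: cvg_step_approx.
Qed.

(** Bounded limits of polynomials in [(t, theta)] have the same integral for both
    measures; indicators of open boxes are such limits, and open boxes form a
    pi-system that generates the Borel sets. *)
Theorem moments_determine mu nu d : moments_of mu d -> moments_of nu d ->
  forall A, measurable A -> mu A = nu A.
Proof.
move=> mud nud; have mufin := moments_of_fin mud; have nufin := moments_of_fin nud.
pose G := [set A : set (borelRn R n) | exists lo hi, A = open_box lo hi].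
have mG : G `<=` measurable.
  by move=> _ [lo [hi ->]]; exact: (measurable_open_Rn (@open_open_box R n lo hi)).
have measG : @measurable _ (borelRn R n) = <<s G >>.
  apply/seteqP; split; last by apply: smallest_sub => //; exact: smallest_sigma_algebra.
  apply: smallest_sub; first exact: smallest_sigma_algebra.
  move=> U oU; rewrite (@open_bigcup_rational_box R n U oU).
  apply: (@bigcup_measurable _ (g_sigma_algebraType G)) => k _.
  rewrite /rational_box; case: choice.unpickle => [f|]; last exact: measurable0.
  by apply: sub_sigma_algebra; do 2 eexists; reflexivity.
rewrite measG => A GA.
(* The cubes of side [2 k] are the cover that the uniqueness theorem asks for. *)
apply: (@g_sigma_algebra_measure_unique _ R (borelRn R n) G mG
  (fun k => open_box (fun=> - k%:R) (fun=> k%:R))) => //.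
- by move=> k; exists (fun=> - k%:R), (fun=> k%:R).
- apply/seteqP; split => // t _; exists (\sum_j (Num.bound `|(t : 'rV[R]_n) ord0 j|))%N => // j.
  rewrite -ltr_norml; apply: lt_le_trans (archi_boundP (normr_ge0 _)) _.
  by rewrite ler_nat (bigD1 j)//= leq_addr.
- move=> _ _ [lo [hi ->]] [lo' [hi' ->]].
  exists (fun j => Num.max (lo j) (lo' j)), (fun j => Num.min (hi j) (hi' j)).
  apply/seteqP; split => t /=.
    by move=> [tb tb'] j; rewrite gt_max lt_min; have /andP[-> ->] := tb j; have /andP[-> ->] := tb' j.
  by move=> tb; split=> j; have := tb j; rewrite gt_max lt_min => /andP[/andP[l1 l2] /andP[h1 h2]];
    rewrite ?l1 ?l2 ?h1 ?h2.
- move=> _ [lo [hi ->]]; have [g [g1 gl]] := box_indicator_limit lo hi.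
  have val rho : moments_of rho d -> (rho setT < +oo)%E ->
      coef_functional d (g k) @[k --> \oo] --> fine (rho (open_box lo hi)).
    move=> rhod rhofin.
    have [c Ic gc] := has_integral_lim (fun k => moments_of_poly (g k) rhod) gl
      (has_integral_cst 1 rhofin) g1.
    have := has_integral_indic rhofin (measurable_open_Rn (@open_open_box R n lo hi)).
    by move=> /(has_integral_unique Ic) <-.
  have fin (rho : {measure set (borelRn R n) -> \bar R}) : (rho setT < +oo)%E -> rho (open_box lo hi) \is a fin_num.
    move=> rhofin; rewrite ge0_fin_numE//; apply: le_lt_trans rhofin.
    by apply: le_measure; rewrite ?inE//; exact: (measurable_open_Rn (@open_open_box R n lo hi)).
  rewrite -(fineK (fin mu mufin)) -(fineK (fin nu nufin)); congr EFin.
  exact: (cvg_unique _ (val mu mud mufin) (val nu nud nufin)).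
- move=> k; apply: le_lt_trans mufin; apply: le_measure; rewrite ?inE//.
  exact: (measurable_open_Rn (@open_open_box R n _ _)).
Qed.

End MomentMeasures.

(** * Existence *)

Section Pushforward.
Context d1 d2 (T1 : measurableType d1) (T2 : measurableType d2) (R : realType).
Variables (mu : {measure set T1 -> \bar R}) (phi : T1 -> T2).
Hypothesis mphi : measurable_fun setT phi.

Lemma has_integral_pushforward : exists nu : {measure set T2 -> \bar R},
  forall (f : T2 -> R) c, measurable_fun setT f ->
    has_integral mu (fun x => f (phi x)) c -> has_integral nu f c.
Proof.
exists (pushforward mu phi) => f c mf [intf fc].
have mf' : measurable_fun setT (EFin \o f) by exact/measurable_EFinP.
split; first exact: (integrable_pushforward mphi).
by rewrite (integral_pushforward mphi).
Unshelve. all: exact: mphi.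
Qed.

End Pushforward.

Section Existence.
Variables (R : realType) (n m : nat).
Variables (I : 'I_m -> {fset multinom n}) (a : 'I_m -> multinom n -> R).
Local Notation eval_at := (rational_eval I a).
Local Notation wt t := (weight_value I a ((t : 'rV[R]_n) ord0)).
Implicit Types (mu : {measure set (borelRn R n) -> \bar R})
  (d : multinom n.+1 -> R) (gamma : multinom n -> R).

Lemma join_monomial (alpha : multinom n) beta :
  \prod_j coord_var R j ^+ alpha j * theta_var R n ^+ beta = mpolyX R (mnm_join alpha beta).
Proof.
have mnm1_join j : mnm1 (widen_ord (leqnSn n) j) = mnm_join (mnm1 j) 0 :> multinom n.+1.
  apply/mnmP => i; rewrite mnm1E; case: (unliftP ord_max i) => [k ->|->].
    by rewrite -widen_lift mnm_join_widen mnm1E -!val_eqE.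
  by rewrite mnm_join_max widen_lift eq_sym (negbTE (neq_lift _ _)).
have mnm1_max : mnm1 ord_max = mnm_join (@mnm0 n) 1.
  apply/mnmP => i; rewrite mnm1E; case: (unliftP ord_max i) => [k ->|->].
    by rewrite (negbTE (neq_lift _ _)) -widen_lift mnm_join_widen mnm0E.
  by rewrite mnm_join_max eqxx.
rewrite [RHS]mpolyXE_id big_ord_recr /= mnm_join_max mnm1_max; congr (_ * _).
by apply: eq_bigr => j _; rewrite mnm_join_widen mnm1_join.
Qed.

(** The law of the random point [T] of [unbounded_representation].  The form kills the
    square of [theta_var * weight - 1], so the random value [Y] of [theta] is almost
    surely the inverse of the weight at [T]. *)
Theorem moments_exist d gamma : real_extension I a gamma d ->
  exists mu, moments_of I a mu d.
Proof.
move=> [sq _ rec _].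
have sq1 : positive (coef_functional d) 1 by move=> h; rewrite mul1r; exact: sq.
have cone_q : cone (coef_functional d) (\sum_k lifted I a k ^+ 2).
  by apply: cone_sum => k _; exact: cone_sqr.
have rel : equiv (coef_functional d) (theta_var R n * weight I a) 1.
  by move=> h; apply: etrans (rec h) _; rewrite mul1r.
have [nu [T [Y [nufin mT mY IT]]]] := unbounded_representation sq1 cone_q rel.
have Ipoly f : has_integral nu (fun s => meval (extend_point (Y s) (T s)) f)
    (coef_functional d f).
  have IX al : has_integral nu (fun s => meval (extend_point (Y s) (T s)) (mpolyX R al))
      (d al).
    rewrite -{2}(mnm_splitK al) -(coef_functionalX d) -join_monomial.
    apply: eq_has_integral (IT (mnm_split al).1 (mnm_split al).2) => s.
    by rewrite -[in RHS](mnm_splitK al) meval_join.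
  apply: eq_has_integral (has_integral_sum (msupp f)
    (fun al => has_integralZ (mcoeff al f) (IX al))) => s.
  rewrite [in RHS](mpolyE f) raddf_sum; apply: eq_bigr => al _ /=.
  by rewrite mevalZ.
have YE : {ae nu, forall s, Y s = (weight_value I a (T s))^-1}.
  have := Ipoly ((theta_var R n * weight I a - 1) ^+ 2).
  have -> : coef_functional d ((theta_var R n * weight I a - 1) ^+ 2) = 0.
    rewrite expr2 mulrBl mul1r raddfB /= rec; exact: subrr.
  move=> /has_integral_eq0 H.
  have {H} := H (fun s => _); rewrite /= => H.
  apply: filterS (H _) => [s|s].
    rewrite rmorphXn /= mevalB mevalM meval_theta meval_weight meval1 => /eqP.
    rewrite sqrf_eq0 subr_eq0 => /eqP E.
    by rewrite -[LHS]mulr1 -(mulfV (lt0r_neq0 (weight_value_gt0 I a (T s)))) mulrA E mul1r.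
  by rewrite rmorphXn; exact: sqr_ge0.
pose X s : 'rV[R]_n := \row_j T s j.
have mX : measurable_fun setT (X : measurableTypeR R -> borelRn R n).
  by apply: measurable_fun_Rn => j; under eq_fun do rewrite mxE; exact: mT.
have [mu muP] := has_integral_pushforward nu mX.
exists mu => al; apply: muP; first exact: measurable_rational_eval.
rewrite -(coef_functionalX d).
have XE s : X s ord0 = T s by apply/funext => j; rewrite mxE.
apply: (@has_integral_ae _ _ _ nu _ _ _ _ _ (Ipoly (mpolyX R al))).
  exact: (measurableT_comp (measurable_rational_eval I a (mpolyX R al)) mX).
have [N [mN N0 YN]] := YE; exists N; split => // s /= ne; apply: YN => /= E; apply: ne.
by rewrite /rational_eval XE -E.
Qed.

End Existence.

(** * Support, moments and the theorem *)

Section RealEvaluation.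
Local Open Scope complex_scope.
Variables (R : realType) (n : nat).

Lemma real_evalE (g : mpoly n R) t :
  real_eval g t = \sum_(al <- msupp g) mcoeff al g * monomial al t.
Proof. by rewrite /real_eval mevalE. Qed.

Lemma continuous_real_eval (g : mpoly n R) : continuous (real_eval g).
Proof.
have -> : real_eval g = fun t => \sum_(al <- msupp g) mcoeff al g * monomial al t.
  by apply/funext => t; exact: real_evalE.
have cont_monomial al : continuous (@monomial R n al).
  apply: continuous_big => [|j _]; first exact: mul_continuous.
  move=> t; apply: (@continuous_comp _ _ _ (fun s : 'rV[R]_n => s ord0 j) (fun y => y ^+ al j)).
    exact: coord_continuous.
  exact: exprn_continuous.
apply: continuous_big => [|al _]; first exact: add_continuous.
move=> t; apply: (@continuous_comp _ _ _ (@monomial R n al) ( *%R (mcoeff al g))).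
  exact: cont_monomial.
exact: mulrl_continuous.
Qed.

Lemma complex_eval_real (q : mpoly n R) t :
  complex_eval (map_mpoly (real_complex R) q) t = (real_eval q t)%:C.
Proof.
have -> : map_mpoly (real_complex R) q
    = \sum_(al <- msupp q) (mcoeff al q)%:C *: mpolyX R[i] al.
  rewrite {1}[q]mpolyE raddf_sum; apply: eq_bigr => al _ /=.
  by rewrite map_mpolyZ map_mpolyX.
rewrite real_evalE rmorph_sum /complex_eval raddf_sum; apply: eq_bigr => al _ /=.
rewrite mevalZ mevalX rmorphM; congr (_ * _).
by rewrite rmorph_prod; apply: eq_bigr => j _; rewrite rmorphXn.
Qed.

Lemma complex_eval_pair (f f' : mpoly n R[i]) t (x y : R) :
  complex_eval f t = x%:C -> complex_eval f' t = y%:C ->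
  complex_eval (f + 'i%C *: f') t = Complex x y.
Proof. by rewrite /complex_eval => fx fy; rewrite mevalD mevalZ fx fy; simpc. Qed.

Lemma complex_eval_split (f : mpoly n R[i]) : exists g h : mpoly n R,
  forall t, complex_eval f t = Complex (real_eval g t) (real_eval h t).
Proof.
have [g [h ->]] := complex_mpoly_split f; exists g, h => t.
by apply: complex_eval_pair; exact: complex_eval_real.
Qed.

End RealEvaluation.

Section Correspondence.
Local Open Scope complex_scope.
Variables (R : realType) (n m : nat).
Variables (p : 'I_m -> mpoly n R).
Variables (I : 'I_m -> {fset multinom n}) (a : 'I_m -> multinom n -> R).
Hypothesis pE : forall k, p k = \sum_(xi <- I k) a k xi *: mpolyX R xi.
Local Notation eval_at := (rational_eval I a).
Local Notation wt t := (weight_value I a ((t : 'rV[R]_n) ord0)).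
Local Notation K :=
  (\bigcap_(k in [set: 'I_m]) (real_eval (p k) @^-1` [set y | 0 <= y])).
Implicit Types (mu : {measure set (borelRn R n) -> \bar R})
  (d : multinom n.+1 -> R) (gamma : multinom n -> R).

Lemma real_eval_lifted k t : real_eval (p k) t = lifted_value I a k (t ord0).
Proof.
rewrite /real_eval pE raddf_sum; apply: eq_bigr => xi _ /=.
by rewrite mevalZ mevalX.
Qed.

(** Let [F] be the nonnegative function [- p_k theta^2] cut down to the set where
    [p_k < 0].  Approximating the indicator of this set by step polynomials [g] in
    [- theta p_k], positivity of [p_k L] at [(theta g)^2] shows that [F] has an integral at
    most 0.  So the open set where [p_k < 0] is null, hence misses the support. *)
Lemma support_of_moments mu d gamma : real_extension I a gamma d ->
  moments_of I a mu d -> msupport mu `<=` K.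
Proof.
move=> [_ _ _ pos] mud t suppt k _ /=; rewrite leNgt; apply/negP => pk_lt0.
pose N := [set t | real_eval (p k) t < 0].
have oN : open N.
  rewrite (_ : N = real_eval (p k) @^-1` [set y | y < 0])//.
  by apply: open_comp; [move=> s _; exact: continuous_real_eval | exact: open_lt].
have := suppt N oN pk_lt0; suff -> : mu N = 0%E by rewrite ltxx.
have mufin := moments_of_fin mud.
have mN : measurable (N : set (borelRn R n)) by exact: measurable_open_Rn.
pose lv t := lifted_value I a k ((t : 'rV[R]_n) ord0).
pose s : mpoly n.+1 R := - (theta_var R n * lifted I a k).
have sE t' : eval_at s t' = - ((wt t')^-1 * lv t').
  by rewrite /rational_eval mevalN mevalM meval_theta meval_lifted.
have wt_gt0 t' : 0 < wt t' by exact: weight_value_gt0.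
have ratio1 t' : `|(wt t')^-1 * lv t'| <= 1.
  rewrite normrM gtr0_norm ?invr_gt0// mulrC ler_pdivrMr// mul1r.
  exact: lifted_le_weight.
have s1 t' : `|eval_at s t'| <= 1 by rewrite sE normrN.
have s_gt0 t' : (0 < eval_at s t') = (lv t' < 0).
  by rewrite sE oppr_gt0 pmulr_rlt0 ?invr_gt0.
have /choice[g gP] := fun j => @step_approx_poly _ _ _ I a s j.
pose h j : mpoly n.+1 R := lifted I a k * (theta_var R n * g j) ^+ 2.
have hE j t' : eval_at (h j) t' =
    ((wt t')^-1 * lv t') * ((wt t')^-1 * (step_approx j (eval_at s t')) ^+ 2).
  rewrite /rational_eval mevalM rmorphXn /= mevalM meval_theta meval_lifted.
  by rewrite -/(rational_eval I a (g j) t') gP /lv; ring.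
pose F t' := - (((wt t')^-1 * lv t') * ((wt t')^-1 * (lv t' < 0)%R%:R ^+ 2)).
have F_ge0 t' : 0 <= F t'.
  rewrite /F; have [l0|_] := ltP (lv t') 0; last by rewrite expr0n !mulr0 oppr0.
  by rewrite -mulNr mulr_ge0 ?mulr_ge0 ?sqr_ge0 ?invr_ge0 ?(ltW (wt_gt0 t'))// -mulrN
     mulr_ge0 ?invr_ge0 ?(ltW (wt_gt0 t'))// oppr_ge0 ltW.
have hF t' : eval_at (h j) t' @[j --> \oo] --> - F t'.
  rewrite /F opprK; under eq_fun do rewrite hE.
  apply: cvgM; first exact: cvg_cst.
  apply: cvgM; first exact: cvg_cst.
  under eq_fun do rewrite expr2.
  by rewrite expr2 -s_gt0; apply: cvgM; exact: cvg_step_approx.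
have h1 j t' : `|eval_at (h j) t'| <= 1.
  rewrite hE normrM mulr_ile1// normrM mulr_ile1//.
    by have /andP[? ?] := inv_weight_itv I a t'; rewrite ger0_norm// ltW.
  by rewrite normrX exprn_ile1// step_approx_itv.
have [c Ic hc] := has_integral_lim (fun j => moments_of_poly (h j) mud) hF
  (has_integral_cst 1 mufin) h1.
have c_ge0 : 0 <= c by apply: (cvgr_to_ge hc); apply: nearW => j; exact: pos.
have IF : has_integral mu F (- c).
  by apply: eq_has_integral (has_integralN Ic) => t'; rewrite opprK.
have c0 : c = 0.
  by apply/le_anti; rewrite c_ge0 andbT -oppr_ge0; exact: (has_integral_ge0 IF).
rewrite c0 oppr0 in IF; have [A [mA A0 NA]] := has_integral_eq0 IF F_ge0.
apply/eqP; rewrite -measure_le0 -A0; apply: le_measure; rewrite ?inE//.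
move=> t' Nt'; apply: NA => /= /eqP; rewrite /F oppr_eq0.
have lv0 : lv t' < 0 by rewrite /lv -real_eval_lifted.
by rewrite lv0 expr1n mulr1 !mulf_eq0 invr_eq0 (gt_eqF (wt_gt0 t')) (lt_eqF lv0).
Qed.

Definition embed (g : mpoly n R) : mpoly n.+1 R :=
  \sum_(al <- msupp g) mcoeff al g *: mpolyX R (mnm_join al 0).

Lemma eval_embed g t : eval_at (embed g) t = real_eval g t.
Proof.
rewrite /rational_eval /embed raddf_sum real_evalE; apply: eq_bigr => al _ /=.
by rewrite mevalZ meval_join expr0 mulr1.
Qed.

Lemma measurable_real_eval g :
  measurable_fun setT (fun t : borelRn R n => real_eval g (t : 'rV[R]_n)).
Proof.
rewrite (_ : (fun t => _) = (fun t : borelRn R n => eval_at (embed g) (t : 'rV[R]_n))).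
  exact: measurable_rational_eval.
by apply/funext => t; rewrite eval_embed.
Qed.

Lemma representing_of_moments mu d gamma : real_extension I a gamma d ->
  moments_of I a mu d -> representing gamma mu.
Proof.
move=> [_ gd _ _] mud; split=> [f|alpha]; last first.
  rewrite gd -(mud (mnm_join alpha 0)).2; apply: eq_integral => t _.
  by rewrite rational_eval_monomial expr0 mulr1.
have [g [h fE]] := complex_eval_split f.
have normE t : ComplexField.Normc.normc (complex_eval f t) = (real_eval (g ^+ 2 + h ^+ 2) t) `^ 2^-1.
  rewrite fE /= /real_eval mevalD !rmorphXn /= powR12_sqrt//.
  by rewrite addr_ge0// sqr_ge0.
have sq_ge0 t : 0 <= real_eval (g ^+ 2 + h ^+ 2) t.
  by rewrite /real_eval mevalD !rmorphXn /= addr_ge0// sqr_ge0.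
have mf : measurable_fun setT
    (fun t : borelRn R n => ComplexField.Normc.normc (complex_eval f (t : 'rV[R]_n))).
  rewrite (_ : (fun t => _) = (fun y => y `^ 2^-1) \o
    (fun t : borelRn R n => real_eval (g ^+ 2 + h ^+ 2) (t : 'rV[R]_n))).
    apply: measurableT_comp; [exact: measurable_powR | exact: measurable_real_eval].
  by apply/funext => t /=; exact: normE.
rewrite inE; apply/andP; split; rewrite inE/=; first exact: mf.
rewrite /finite_norm unlock; apply: poweR_lty.
have [intf _] := moments_of_poly (embed (g ^+ 2 + h ^+ 2)) mud.
have /integrableP[_] := intf; apply: le_lt_trans; rewrite le_eqVlt; apply/orP; left; apply/eqP.
apply: eq_integral => t _ /=.
rewrite normE eval_embed ger0_norm ?powR_ge0// ger0_norm//.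
by rewrite -powRrM mulVf ?pnatr_eq0// powRr1.
Qed.

(** Since [theta <= 1], the monomial [t^alpha theta^beta] is dominated by
    1 + (t^alpha)^2, integrable by assumption.  Multiplication by [p_k] preserves
    positivity because [p_k] is nonnegative on the support, whose complement is null. *)
Lemma moments_of_representing mu gamma : representing_on K gamma mu ->
  exists d, moments_of I a mu d /\ real_extension I a gamma d.
Proof.
move=> [[L2 gammaE] suppK].
have sqint g : exists c,
    has_integral mu (fun t : borelRn R n => real_eval g (t : 'rV[R]_n) ^+ 2) c.
  apply: integrable_has_integral.
  have := Lfun2_integrable_sqr (L2 (map_mpoly (real_complex R) g)).
  rewrite (_ : EFin \o _ = (fun t => (real_eval g t ^+ 2)%:E))//.
  apply/funext => t /=; rewrite complex_eval_real /= expr0n addr0 sqr_sqrtr//.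
  exact: sqr_ge0.
have mufin : (mu setT < +oo)%E.
  have [c Ic] := sqint 1.
  apply: (@has_integral1_fin _ _ mu c); apply: eq_has_integral Ic => t.
  by rewrite /real_eval meval1 expr1n.
have intX al : exists c, has_integral mu (eval_at (mpolyX R al)) c.
  have [c Ic] := sqint (mpolyX R (mnm_split al).1).
  apply: dominated_has_integral (has_integralD (has_integral_cst 1 mufin) Ic).
    exact: measurable_rational_eval.
  move=> t; rewrite -[X in eval_at (mpolyX R X)](mnm_splitK al) rational_eval_monomial.
  have -> : real_eval (mpolyX R (mnm_split al).1) t = monomial (mnm_split al).1 t by exact: mevalX.
  set x := monomial _ t; rewrite normrM; apply: (@le_trans _ _ `|x|).
    apply: ler_piMr => //; have /andP[w0 w1] := inv_weight_itv I a t.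
    by rewrite ger0_norm ?exprn_ge0 ?exprn_ile1// ltW.
  by have := sqr_ge0 (`|x| - 1); rewrite -(real_normK (num_real x)); nra.
have [d mud] := choice intX; exists d; split; first exact: mud.
split.
- move=> g; apply: (has_integral_ge0 (moments_of_poly (g ^+ 2) mud)) => t.
  by rewrite /rational_eval rmorphXn sqr_ge0.
- move=> alpha; apply: EFin_inj; rewrite gammaE -(mud (mnm_join alpha 0)).2.
  by apply: eq_integral => t _; rewrite rational_eval_monomial expr0 mulr1.
- move=> h; apply: (has_integral_unique (moments_of_poly _ mud)).
  apply: eq_has_integral (moments_of_poly h mud) => t.
  by rewrite rational_eval_relation.
move=> k g; pose F (t : borelRn R n) := eval_at (lifted I a k * g ^+ 2) t.
have IF : has_integral mu F (coef_functional d (lifted I a k * g ^+ 2)).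
  exact: moments_of_poly.
have mF : measurable_fun setT F by exact: has_integral_measurable IF.
suff : has_integral mu (fun t => `|F t|) (coef_functional d (lifted I a k * g ^+ 2)).
  by move=> /has_integral_ge0; apply.
apply: has_integral_ae IF; first exact: measurableT_comp.
have [N [mN N0 NS]] := msupport_setC_negligible mu; exists N; split => // t /= neq.
apply: NS => /= suppt; apply: neq; rewrite ger0_norm//.
rewrite /F /rational_eval mevalM meval_lifted rmorphXn mulr_ge0 ?sqr_ge0//.
by rewrite -real_eval_lifted; exact: (suppK t suppt k Logic.I).
Qed.

End Correspondence.

Lemma moments_of_eq (R : realType) (n m : nat) (I : 'I_m -> {fset multinom n})
    (a : 'I_m -> multinom n -> R) (mu nu : {measure set (borelRn R n) -> \bar R}) d :
  (forall A, measurable A -> mu A = nu A) -> moments_of I a mu d -> moments_of I a nu d.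
Proof.
move=> munu mud al; have [int_mu Emu] := mud al.
have E (f : borelRn R n -> \bar R) : (\int[nu]_x f x = \int[mu]_x f x)%E.
  by apply: eq_measure_integral => A mA _; rewrite munu.
split; last by rewrite E.
by have /integrableP[mf fin] := int_mu; apply/integrableP; split => //; rewrite E.
Qed.

Theorem theorem2p7 (R : realType) (n : nat) (n_gt0 : (0 < n)%N)
    (gamma : multinom n -> R) (gamma0_gt0 : 0 < gamma (@mnm0 n))
    (m : nat) (p : 'I_m -> {mpoly R[n]})
    (I : 'I_m -> {fset multinom n}) (a : 'I_m -> multinom n -> R)
    (pE : forall k, p k = \sum_(xi <- I k) a k xi *: mpolyX R xi) :
  let K := \bigcap_(k in [set: 'I_m]) (real_eval (p k) @^-1` [set y | 0 <= y]) in
  ((exists mu : {measure set (borelRn R n) -> \bar R},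
      representing_on K gamma mu) <->
   (exists delta : multinom n * nat -> R[i], extension I a gamma delta)) /\
  ((exists mu : {measure set (borelRn R n) -> \bar R},
      representing_on K gamma mu /\
      forall nu : {measure set (borelRn R n) -> \bar R},
        representing_on K gamma nu ->
        forall A, measurable A -> mu A = nu A) <->
   (exists delta : multinom n * nat -> R[i],
      extension I a gamma delta /\
      forall delta' : multinom n * nat -> R[i],
        extension I a gamma delta' -> delta =1 delta')).
Proof.
move=> K.
have measure_of d : real_extension I a gamma d ->
    exists mu, representing_on K gamma mu /\ moments_of I a mu d.
  move=> dext; have [mu mud] := moments_exist dext; exists mu; split=> //; split.
    exact: representing_of_moments dext mud.
  exact: (support_of_moments pE dext mud).
split; split.
- move=> [mu /(moments_of_representing pE)[d [_ dext]]].
  by eexists; apply/extension_realE; exact: dext.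
- move=> [delta /extension_is_real[d [dext _]]].
  by have [mu [muK _]] := measure_of d dext; exists mu.
- move=> [mu [muK mu_unique]].
  have [d [mud dext]] := moments_of_representing pE muK.
  exists (fun ab => (d (mnm_join ab.1 ab.2))%:C%C); split; first exact/extension_realE.
  move=> delta' /extension_is_real[d' [dext' ->]] ab.
  have [nu [nuK nud']] := measure_of d' dext'.
  have nud := moments_of_eq (mu_unique nu nuK) mud.
  by rewrite (has_integral_unique (nud _) (nud' _)).
move=> [delta [/extension_is_real[d [dext ->]] delta_unique]].
have [mu [muK mud]] := measure_of d dext; exists mu; split=> // nu nuK.
have [d' [nud' dext']] := moments_of_representing pE nuK.
have dd' : d = d'.
  apply/funext => al.
  have := delta_unique _ ((extension_realE I a gamma d').2 dext') (mnm_split al).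
  by move=> /complexI /=; rewrite mnm_splitK.
by rewrite -dd' in nud'; exact: moments_determine mud nud'.
Qed.
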